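(* For each integer $r \geq 2$, there exist an integer $d_0 = d_0(r) \geq 1$ and a real number $c = c(r) > 0$ such that for all $d \geq d_0$ the following holds: if $G$ is a graph of maximum degree at most $d$ and chromatic number at most $r$, then \[\chi_{DPP}(G) \leq sd^{(3)}(G) \leq d - c\sqrt{d \log d}.\]
   Context: All graphs are finite and simple. DP-paintability: given $f:V(G)\to\mathbb N$, the DP-$f$-painting game is played by Lister and Painter. Each vertex $v$ starts with $f(v)$ tokens and is unmarked. On each turn Lister removes some number $g(v)\ge 0$ of tokens from each vertex $v$ (with $g(v)\ge1$ for some $v$), and then produces a graph $H$ and a map $L:V(G)\to 2^{V(H)}$ such that: the sets $L(v)$ partition $V(H)$; $|L(v)|=g(v)$; any two elements of the same $L(v)$ are adjacent in $H$; if $a\in L(u)$, $b\in L(v)$ with $u\ne v$ are adjacent in $H$ then $uv\in E(G)$; and for $uv\in E(G)$ the edges of $H$ between $L(u)$ and $L(v)$ form a (possibly empty) matching. Painter then chooses an independent set $I$ of $H$ and marks every $v$ with $L(v)\cap I\neq\emptyset$. The game ends when all tokens are gone; Painter wins if all vertices are marked. $\chi_{DPP}(G)$ is the minimum $k$ such that Painter has a winning strategy for the constant function $f\equiv k$. Strict type 3 degeneracy: for a graph $G$ and positive-valued $f:V(G)\to\mathbb N$, the operation $\mathsf{ReduceValue}_v(G,f)$ returns $(G,f')$ with $f'(v)=f(v)-1$ and $f'=f$ elsewhere; for an edge $vw$, $\mathsf{EdgeDelete}_{vw}(G,f)$ returns $(G-vw,f')$ with $f'(v)=f(v)-f(w)$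 and $f'=f$ elsewhere. The pair $(G,f)$ is strict type 3 degenerate if repeated application of these operations reduces it to an edgeless graph together with a positive-valued function (equivalently: $(H,g)$ with $H$ edgeless and $g$ positive is strict type 3 degenerate, and $(G,f)$ is strict type 3 degenerate if some single $\mathsf{ReduceValue}$ or $\mathsf{EdgeDelete}$ operation yields a strict type 3 degenerate pair). $sd^{(3)}(G)$ is the least integer $k$ such that $(G,f)$ is strict type 3 degenerate for the constant function $f\equiv k$. $\log$ denotes the natural logarithm. *)

(* Defs.v *)
From mathcomp Require Import all_boot.
From Stdlib Require Import ZArith.
Set Implicit Arguments. Unset Strict Implicit. Unset Printing Implicit Defensive.

Definition simple_graph (T : finType) (e : rel T) : Prop :=
  (forall u v, e u v = e v u) /\ (forall v, ~~ e v v).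

Definition max_degree_le (T : finType) (e : rel T) (d : nat) : Prop :=
  forall v : T, #|[set u | e v u]| <= d.

Definition colorable (T : finType) (e : rel T) (r : nat) : Prop :=
  exists col : T -> 'I_r, forall u v, e u v -> col u != col v.

(* A Lister move removing g(v) tokens from v. The auxiliary graph H has
   vertex set V(H) = { (v,i) | i < g v }, with L(v) = { (v,i) | i < g v }
   (any H with a partition into sets L(v) of sizes g(v) is isomorphic to one
   of this form).  Within each L(v) all vertices are adjacent (clique);
   the edges between distinct L(u), L(v) are given by the symmetric
   relation h. *)
Definition valid_cover (T : finType) (e : rel T) (g : T -> nat)
  (h : rel (T * nat)) : Prop :=
  (forall x y, h x y = h y x) /\
  (forall u v i j, u != v -> i < g u -> j < g v -> h (u, i) (v, j) -> e u v) /\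
  (forall u v i j j', u != v -> i < g u -> j < g v -> j' < g v ->
     h (u, i) (v, j) -> h (u, i) (v, j') -> j = j').

(* An independent set I of H: since each L(v) is a clique, I contains at most
   one element (v, i) per v; encoded by sel v = Some i. *)
Definition indep_sel (T : finType) (g : T -> nat) (h : rel (T * nat))
  (sel : T -> option nat) : Prop :=
  (forall v i, sel v = Some i -> i < g v) /\
  (forall u v i j, u != v -> sel u = Some i -> sel v = Some j -> ~~ h (u, i) (v, j)).

(* Painter has a winning strategy from the position with t(v) tokens on v
   and marked set M. *)
Inductive painter_wins (T : finType) (e : rel T) : (T -> nat) -> {set T} -> Prop :=
| pw_end (t : T -> nat) (M : {set T}) :
    (forall v, t v = 0) -> M = setT -> painter_wins e t M
| pw_step (t : T -> nat) (M : {set T}) :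
    (exists v, 0 < t v) ->
    (forall (g : T -> nat) (h : rel (T * nat)),
        (forall v, g v <= t v) -> (exists v, 0 < g v) -> valid_cover e g h ->
        exists sel : T -> option nat,
          indep_sel g h sel /\
          painter_wins e (fun v => t v - g v)
                         (M :|: [set v | sel v != None])) ->
    painter_wins e t M.

Definition is_chi_DPP (T : finType) (e : rel T) (k : nat) : Prop :=
  painter_wins e (fun _ => k) set0 /\
  forall k', painter_wins e (fun _ => k') set0 -> k <= k'.

Definition upd (T : finType) (f : T -> Z) (v : T) (a : Z) : T -> Z :=
  fun x => if x == v then a else f x.

Definition del_edge (T : finType) (E : rel T) (v w : T) : rel T :=
  fun x y => E x y && ~~ (((x == v) && (y == w)) || ((x == w) && (y == v))).

Inductive sd3 (T : finType) : rel T -> (T -> Z) -> Prop :=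
| sd3_edgeless (E : rel T) (f : T -> Z) :
    (forall u v, ~~ E u v) -> (forall v, (0 < f v)%Z) -> sd3 E f
| sd3_reduce (E : rel T) (f : T -> Z) (v : T) :
    (forall u, (0 < f u)%Z) -> sd3 E (upd f v (f v - 1)%Z) -> sd3 E f
| sd3_edel (E : rel T) (f : T -> Z) (v w : T) :
    (forall u, (0 < f u)%Z) -> E v w ->
    sd3 (del_edge E v w) (upd f v (f v - f w)%Z) -> sd3 E f.

Definition is_sd3 (T : finType) (e : rel T) (k : nat) : Prop :=
  sd3 e (fun _ => Z.of_nat k) /\
  forall k', sd3 e (fun _ => Z.of_nat k') -> k <= k'.

(* Main.v *)
(** Painter: a winning strategy is read off a strict type 3 reduction. When an edge
    [vw] is deleted at cost [f w], the at most [g w] cover elements of [v] matched to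
    [w] may be discarded in the current round, and the reduced pair still has enough
    tokens.

    Degeneracy: put [k = d - s]. Deleting vertices one at a time costs every later
    neighbour one unit, so a vertex is harmless as soon as more than [s] of its
    neighbours come after it; and while [v] still has many tokens it can spare
    (at cost [f w] each) several neighbours [w] whose value is small. The order is
    built from its end. If no vertex outside the current final set [C] can be put in
    front of it, then every outside vertex has at least [k] outside neighbours, and
    averaging over colour classes gives [A] (independent) and [B] outside [C] such
    that every vertex of one has linearly many neighbours in the other. Choose sparse
    random subsets [UA] of [A] and [UB] of [B] and process [B \ UB], [A \ UA], [UB],
    [UA]: only [UA] can run out. The vertices of [B \ UB] keep linearly many tokens
    and go in random phases [j], in which a vertex of [UA] has about [d / 2^j]
    neighbours left, so that a deleted vertex can afford to spare about [2^j] of them;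
    each of the order of [log d] phases then contributes equally, which gives
    [sqrt (d log d)] savings. The local lemma makes all random choices good at once. *)

Require Import Defs.
From mathcomp Require Import all_boot all_order all_algebra.
From mathcomp Require Import zify lra.
From Stdlib Require Import ZArith Reals Classical.
Set Implicit Arguments. Unset Strict Implicit. Unset Printing Implicit Defensive.

Local Notation "m ^ n" := (expn m n) : nat_scope.

(** * Strict type 3 degenerate pairs are won by Painter *)

Lemma sd3_pos (T : finType) (E : rel T) f : sd3 E f -> forall v, (0 < f v)%Z.
Proof. by case. Qed.

Lemma eq_sd3 (T : finType) (E : rel T) f :
  sd3 E f -> forall E' f', E =2 E' -> f =1 f' -> sd3 E' f'.
Proof.
elim=> {E f} [E f E0 f0|E f v f0 _ IH|E f v w f0 Evw _ IH] E' f' eE ef.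
- apply: sd3_edgeless => [u v|v]; first by rewrite -eE.
  by rewrite -ef.
- apply: (@sd3_reduce _ _ _ v) => [u|]; first by rewrite -ef.
  by apply: IH => // x; rewrite /upd ef; case: eqP.
- apply: (@sd3_edel _ _ _ v w) => [u||]; [by rewrite -ef|by rewrite -eE|].
  apply: IH => [x y|x]; first by rewrite /del_edge eE.
  by rewrite /upd !ef.
Qed.

(** Surplus tokens are removed one at a time by [sd3_reduce], by induction on the total surplus of
    [f] over [g]. *)
Lemma sd3_lower (T : finType) (E : rel T) f g :
  (forall v, (g v <= f v)%Z) -> sd3 E g -> sd3 E f.
Proof.
move=> le_gf sg.
have [n le_n] : exists n : nat, \sum_v Z.to_nat (f v - g v) <= n.
  by exists (\sum_v Z.to_nat (f v - g v)).
elim: n f le_gf le_n => [|n IH] f le_gf le_n.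
  apply: (eq_sd3 sg) => // v.
  move: le_n; rewrite leqn0 sum_nat_eq0 => /forallP/(_ v) /= /eqP.
  have := le_gf v; lia.
have [/existsP[v /Z.ltb_lt lt_v]|/existsPn ge] := boolP [exists v, Z.ltb (g v) (f v)].
  apply: (@sd3_reduce _ _ _ v) => [u|]; first by have := sd3_pos sg u; have := le_gf u; lia.
  apply: IH => [u|]; rewrite /upd.
    by case: eqP => [->|_] //; lia.
  move: le_n; rewrite (bigD1 v) //= [X in _ -> X <= n](bigD1 v) //= eqxx.
  rewrite [X in _ -> _ + X <= _](eq_bigr (fun i => Z.to_nat (f i - g i))); last first.
    by move=> i /negbTE ->.
  lia.
apply: (eq_sd3 sg) => // v.
have /negbTE/Z.ltb_ge := ge v; have := le_gf v; lia.
Qed.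

Section Painter.
Variable T : finType.

Definition restr (C : {set T}) (e : rel T) : rel T :=
  fun x y => [&& x \in C, y \in C & e x y].

Definition marked (sel : T -> option nat) : {set T} := [set v | sel v != None].

(* Marked vertices stay in the pair, isolated and with the dummy value 1. *)
Definition good_answer (E : rel T) (f : T -> Z) (g : T -> nat) (h : rel (T * nat)) :=
  exists sel, indep_sel g h sel /\
    sd3 (restr (~: marked sel) E)
        (fun v => if v \in marked sel then 1%Z else (f v - Z.of_nat (g v))%Z).

(** Without edges in [E] no two fibres of the cover are joined, so every vertex that receives a
    fibre selects its element 0. A vertex left unmarked has spent nothing. *)
Lemma edgeless_answer E f g h :
  (forall u v, ~~ E u v) -> (forall v, (0 < f v)%Z) ->
  (forall v, (Z.of_nat (g v) <= f v)%Z) -> valid_cover E g h -> good_answer E f g h.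
Proof.
move=> E0 f0 gf [_ [hE _]].
exists (fun v => if 0 < g v then Some 0 else None); split.
  split=> [v i|u v i j uv].
    by case: ifP => // gv [<-].
  case: ifP => // gu [<-]; case: ifP => // gv [<-].
  by apply/negP => /(hE _ _ _ _ uv gu gv); apply/negP.
apply: sd3_edgeless => [u v|v]; first by rewrite /restr (negbTE (E0 u v)) !andbF.
rewrite inE; case: ltnP => //= gv.
have := f0 v; lia.
Qed.

(** The injections [rho v] embed the fibres of a smaller cover into those of the given one. This
    covers withheld elements as well as vertices that are already marked. *)
Lemma valid_cover_sub (E E' : rel T) (g g' : T -> nat) (h h' : rel (T * nat))
    (rho : T -> nat -> nat) :
  (forall x y, h' x y = h' y x) ->
  (forall v i, i < g' v -> rho v i < g v) ->
  (forall v i j, i < g' v -> j < g' v -> rho v i = rho v j -> i = j) ->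
  (forall u v i j, h' (u, i) (v, j) -> h (u, rho u i) (v, rho v j)) ->
  (forall u v i j, i < g' u -> j < g' v -> h' (u, i) (v, j) -> E u v -> E' u v) ->
  valid_cover E g h -> valid_cover E' g' h'.
Proof.
move=> h's rlt rinj h'h EE' [hs [hE hm]]; split=> //; split.
  move=> u v i j uv iu jv hh; apply: (EE' _ _ _ _ iu jv hh).
  by apply: (hE _ _ _ _ uv (rlt _ _ iu) (rlt _ _ jv)); apply: h'h.
move=> u v i j j' uv iu jv jv' h1 h2; apply: (rinj v) => //.
by apply: (hm u v (rho u i)) => //; auto.
Qed.

(** Withholding one element of the fibre of [v] (if there is one) makes the move legal for the
    reduced pair. If [v] stays unmarked, the value left to it in the original pair is at least the
    one left in the reduced pair. *)
Lemma reduce_answer E f g h v :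
  (forall u, (0 < f u)%Z) ->
  (forall g h, (forall u, (Z.of_nat (g u) <= upd f v (f v - 1)%Z u)%Z) -> valid_cover E g h ->
     good_answer E (upd f v (f v - 1)%Z) g h) ->
  (forall u, (Z.of_nat (g u) <= f u)%Z) -> valid_cover E g h -> good_answer E f g h.
Proof.
move=> f0 IH gf hv.
pose g1 u := if u == v then (g v).-1 else g u.
have g1g u : g1 u <= g u by rewrite /g1; case: eqP => [->|//]; exact: leq_pred.
have [||sel [[sg si] ssd]] := IH g1 h.
- by move=> u; rewrite /upd /g1; case: eqP => _ //; have := gf v; have := f0 v; lia.
- apply: (valid_cover_sub (rho := fun _ i => i) _ _ _ _ _ hv) => //; first by case: hv.
  by move=> u i; move/leq_trans; apply.
exists sel; split; first by split=> // u i /sg /leq_trans; apply.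
apply: sd3_lower ssd => u; case: ifP => // um.
by rewrite /upd /g1; case: eqP => [->|_] //; lia.
Qed.

(** Dropping the elements of [v] matched into [w] keeps at least [g v - g w] of them. If both ends
    stay unmarked, [(f v - f w) - (g v - g w)] is the value that deleting [vw] produces from the
    remaining values [f v - g v] and [f w - g w]. *)
Lemma edel_answer E f g h v w :
  symmetric E -> irreflexive E -> (forall u, (0 < f u)%Z) -> E v w ->
  (forall u, (0 < upd f v (f v - f w)%Z u)%Z) ->
  (forall g h, (forall u, (Z.of_nat (g u) <= upd f v (f v - f w)%Z u)%Z) ->
     valid_cover (del_edge E v w) g h ->
     good_answer (del_edge E v w) (upd f v (f v - f w)%Z) g h) ->
  (forall u, (Z.of_nat (g u) <= f u)%Z) -> valid_cover E g h -> good_answer E f g h.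
Proof.
move=> Es Ei f0 Evw f10 IH gf hv.
have vw : v != w by apply: contraTneq Evw => ->; rewrite Ei.
have f1v : (0 < f v - f w)%Z by have := f10 v; rewrite /upd eqxx.
pose K := [pred i | has (fun j => h (v, i) (w, j)) (iota 0 (g w))].
pose s := filter (predC K) (iota 0 (g v)).
have K_le : count K (iota 0 (g v)) <= g w.
  case: (hv) => hs [_ hm].
  pose m i := find (fun j => h (v, i) (w, j)) (iota 0 (g w)).
  have mP i : i \in filter K (iota 0 (g v)) -> m i < g w /\ h (v, i) (w, m i).
    rewrite mem_filter => /andP[Ki _].
    have lt_m : m i < g w by move: Ki; rewrite /= has_find size_iota.
    by split=> //; have := nth_find 0 Ki; rewrite nth_iota.
  rewrite -size_filter -(size_map m) -(size_iota 0 (g w)); apply: uniq_leq_size.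
    rewrite map_inj_in_uniq ?filter_uniq ?iota_uniq // => i j iK jK mij.
    have [lt_m hi] := mP _ iK; have [_ hj] := mP _ jK.
    move: iK jK; rewrite !mem_filter !mem_iota /= !add0n => /andP[_ ig] /andP[_ jg].
    by apply: (hm w v (m i)) => //; rewrite ?(eq_sym w) // hs // mij.
  by move=> _ /mapP[i iK ->]; rewrite mem_iota; have [] := mP _ iK.
have size_s : g v - g w <= size s.
  have := count_predC K (iota 0 (g v)); rewrite size_iota size_filter; lia.
(* When the minimum is [f v - f w], the reduced pair has no token left at [v], so
   [v] gets marked and the edge [vw] no longer matters. *)
pose a := minn (g v - g w) (Z.to_nat (f v - f w)).
pose g1 u := if u == v then a else g u.
pose rho u i := if u == v then nth 0 s i else i.
pose h1 : rel (T * nat) := fun x y => h (x.1, rho x.1 x.2) (y.1, rho y.1 y.2) &&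
  ~~ (((x.1 == v) && (y.1 == w)) || ((x.1 == w) && (y.1 == v))).
have rho_lt u i : i < g1 u -> rho u i < g u.
  rewrite /g1 /rho; case: eqP => // -> ia.
  have : nth 0 s i \in s.
    by apply: mem_nth; apply: leq_trans size_s; apply: leq_trans ia (geq_minl _ _).
  by rewrite mem_filter mem_iota => /andP[].
have [||sel [[sg si] ssd]] := IH g1 h1.
- move=> u; rewrite /upd /g1; case: eqP => _ //; rewrite /a; lia.
- apply: (valid_cover_sub (rho := rho) _ _ _ _ _ hv) => //.
  + move=> x y; rewrite /h1; case: (hv) => -> _; congr (_ && ~~ _).
    by rewrite orbC ![(_ == w) && _]andbC.
  + move=> u i j; rewrite /g1 /rho; case: eqP => // _ ia ja /eqP.
    have sz : a <= size s by apply: leq_trans size_s; exact: geq_minl.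
    rewrite nth_uniq ?filter_uniq ?iota_uniq //; first by move/eqP.
      exact: leq_trans ia _.
    exact: leq_trans ja _.
  + by move=> u u' i j /andP[].
  + by move=> u u' i j _ _ /andP[_ /=]; rewrite /del_edge => -> ->.
exists (fun u => omap (rho u) (sel u)).
have mkE : marked (fun u => omap (rho u) (sel u)) = marked sel.
  by apply/setP => u; rewrite !inE; case: (sel u).
split.
  split=> [u i|u u' i j uu'].
    by case su: (sel u) => [i'|] //= [<-]; apply: rho_lt; apply: sg.
  case su: (sel u) => [i'|] //= [<-]; case su': (sel u') => [j'|] //= [<-].
  have := si _ _ _ _ uu' su su'; rewrite /h1 negb_and negbK /= => /orP[//|].
  have nK i0 j0 : i0 < g1 v -> j0 < g w -> ~~ h (v, rho v i0) (w, j0).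
    rewrite {1}/g1 {1}/rho eqxx => ia jg.
    have : nth 0 s i0 \in s.
      by apply: mem_nth; apply: leq_trans size_s; apply: leq_trans ia (geq_minl _ _).
    rewrite mem_filter => /andP[/= /hasPn nh _].
    by apply: nh; rewrite mem_iota.
  have rw j0 : rho w j0 = j0 by rewrite /rho eq_sym (negbTE vw).
  have gw j0 : j0 < g1 w -> j0 < g w by rewrite /g1 eq_sym (negbTE vw).
  move=> /orP[/andP[/eqP uv /eqP u'w]|/andP[/eqP uw /eqP u'v]]; subst u u'.
    rewrite (rw j'); apply: nK; [exact: sg|exact/gw/sg].
  case: (hv) => -> _; rewrite (rw i'); apply: nK; [exact: sg|exact/gw/sg].
rewrite mkE.
(* A marked vertex becomes isolated. So if [v] or [w] is marked, the pairs with and without the edge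
   [vw] have the same graph, and only the values are to be compared. *)
have [vm|vm] := boolP (v \in marked sel).
  apply: (sd3_lower _ (eq_sd3 ssd _ (fun => erefl))) => [u|x y].
    case: ifP => // um; rewrite /upd /g1; case: eqP => [uv|_]; last lia.
    by rewrite uv vm in um.
  rewrite /restr /del_edge !in_setC; case: (x =P v) => [->|_] /=; first by rewrite vm.
  by case: (y =P v) => [->|_] /=; rewrite ?vm ?andbF ?andbT.
(* [v] is unmarked, so its reduced value is still positive; this rules out [f v - f w] as the
   minimum in [a]. *)
have fv := sd3_pos ssd v; rewrite (negbTE vm) {1}/upd /g1 eqxx in fv.
have av : a = g v - g w by rewrite /a in fv *; lia.
have [wm|wm] := boolP (w \in marked sel).
  apply: (sd3_lower _ (eq_sd3 ssd _ (fun => erefl))) => [u|x y].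
    case: ifP => // um; rewrite /upd /g1; case: eqP => [->|_]; have := gf w; lia.
  rewrite /restr /del_edge !in_setC; case: (x =P w) => [->|_] /=; first by rewrite wm.
  by case: (y =P w) => [->|_] /=; rewrite ?wm ?andbF ?andbT.
have pos u : (0 < if u \in marked sel then 1 else f u - Z.of_nat (g u))%Z.
  case: ifP => // um; have := sd3_pos ssd u; rewrite um /upd /g1.
  by case: eqP => [->|_] //; have := gf w; lia.
apply: (@sd3_edel _ _ _ v w) => //.
  by rewrite /restr !in_setC vm wm.
apply: (sd3_lower _ (eq_sd3 ssd _ (fun => erefl))) => [u|x y].
  rewrite {2}/upd (negbTE vm) (negbTE wm); case: (u =P v) => [->|uv].
    by rewrite (negbTE vm) /upd /g1 eqxx; have := gf w; lia.
  by rewrite /upd /g1; case: eqP => // _; case: ifP => _; lia.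
by rewrite /restr /del_edge !andbA.
Qed.

Lemma sd3_answer E f : sd3 E f -> symmetric E -> irreflexive E ->
  forall g h, (forall u, (Z.of_nat (g u) <= f u)%Z) -> valid_cover E g h -> good_answer E f g h.
Proof.
elim=> {E f} [E f E0 f0|E f v f0 _ IH|E f v w f0 Evw sd IH] Es Ei g h gf hv.
- exact: edgeless_answer.
- by apply: (reduce_answer f0 _ gf hv) => g1 h1; apply: IH.
- apply: (edel_answer Es Ei f0 Evw (sd3_pos sd) _ gf hv) => g1 h1; apply: IH => [x y|x].
    by rewrite /del_edge Es orbC [(x == w) && _]andbC [(x == v) && _]andbC.
  by rewrite /del_edge Ei.
Qed.

(** The invariant, that the unmarked part with its current tokens is strict type 3 degenerate,
    survives each round by [sd3_answer]. The total number of tokens decreases, and when it reaches 0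
    no vertex can be unmarked, as values are positive. *)
Lemma painter_wins_sd3 (E : rel T) f (t : T -> nat) (M : {set T}) :
  symmetric E -> irreflexive E -> sd3 (restr (~: M) E) f ->
  (forall v, v \notin M -> f v = Z.of_nat (t v)) -> painter_wins E t M.
Proof.
move=> Es Ei.
have [n le_n] : exists n : nat, \sum_v t v <= n by exists (\sum_v t v).
elim: n f t M le_n => [|n IH] f t M le_n sd ft.
  apply: pw_end => [v|].
    by move: le_n; rewrite leqn0 sum_nat_eq0 => /forallP/(_ v) /= /eqP.
  apply/setP => v; rewrite inE; apply/negbNE/negP => vM.
  have := sd3_pos sd v; rewrite ft //.
  by move: le_n; rewrite leqn0 sum_nat_eq0 => /forallP/(_ v) /= /eqP ->.
have [/existsP[v0 tv0]|/existsPn t0] := boolP [exists v, 0 < t v]; last first.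
  apply: (IH f) => //; rewrite big1 // => v _; have := t0 v; lia.
apply: pw_step; first by exists v0.
move=> g h gt [v1 gv1] hv.
(* Cover elements over marked vertices are ignored: the value of [f] there is a dummy unrelated to
   [t]. *)
pose g' v := if v \in M then 0 else g v.
have [||||sel [[sg si] ssd]] := sd3_answer sd _ _ (g := g') (h := h).
- by move=> x y; rewrite /restr Es andbCA.
- by move=> x; rewrite /restr Ei !andbF.
- move=> u; rewrite /g'; case: ifP => um; first by have := sd3_pos sd u; lia.
  by rewrite ft ?um //; have := gt u; lia.
- apply: (valid_cover_sub (rho := fun _ i => i) _ _ _ _ _ hv) => //; first by case: hv.
    by move=> u i; rewrite /g'; case: ifP.
  move=> u u' i j; rewrite /g' /restr !inE.
  by case: ifP => //; case: ifP => //= _ _ _ _ _ ->.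
exists sel; split.
  by split=> // u i /sg; rewrite /g'; case: ifP.
apply: (IH (fun v => if v \in marked sel then 1%Z else f v - Z.of_nat (g' v))%Z).
- move: le_n; rewrite (bigD1 v1) //= [X in _ -> X <= n](bigD1 v1) //=.
  have : \sum_(i | i != v1) (t i - g i) <= \sum_(i | i != v1) t i.
    by apply: leq_sum => i _; exact: leq_subr.
  have := gt v1; lia.
- apply: (eq_sd3 ssd) => // x y; rewrite /restr !inE.
  by case: (x \in M); case: (y \in M) => //=; rewrite ?andbF.
- move=> v; rewrite inE negb_or => /andP[vM vs].
  rewrite /marked (negbTE vs) /g' (negbTE vM) ft //; have := gt v; lia.
Qed.

End Painter.

(** * Deletion orders *)

Section Degenerate.
Variables (T : finType) (e : rel T).
Hypotheses (es : symmetric e) (ei : irreflexive e).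

Definition nb v : {set T} := [set u | e v u].
Definition sdn (C : {set T}) (f : T -> nat) := sd3 (restr C e) (fun v => Z.of_nat (f v)).

(** The intermediate graphs while the edges from [v] into [C] are deleted one by one; [X] holds the
    ends of those still present. *)
Definition star (C X : {set T}) (v : T) : rel T := fun x y =>
  [|| restr C e x y, (x == v) && (y \in X) | (y == v) && (x \in X)].

Lemma del_star (C X : {set T}) v w : v \notin C -> X \subset C -> w \in X ->
  del_edge (star C X v) v w =2 star C (X :\ w) v.
Proof.
move=> vC XC wX x y; rewrite /del_edge /star /restr !inE.
have wC := subsetP XC w wX.
have wv : w != v by apply: contraNneq vC => <-.
have vX : v \notin X by apply: contraNN vC; apply/subsetP.
case: (x =P v) => [->|_]; case: (y =P v) => [->|_] /=;
  rewrite ?(negbTE vC) ?(negbTE vX) ?(eq_sym v) ?(negbTE wv) ?andbF ?andbT ?orbF ?orFb //=.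
- by rewrite andbC.
- by rewrite andbC.
Qed.

(** Here the far ends pay: since [f v = 1], each [w] in [X] loses exactly one token when its edge to
    [v] goes. *)
Lemma sdn_star_pay (C X : {set T}) v (f : T -> nat) :
  v \notin C -> X \subset C -> f v = 1 -> (forall w, w \in X -> 1 < f w) ->
  (forall u, 0 < f u) ->
  (forall f' : T -> nat, (forall u, 0 < f' u) ->
     (forall w, w \in C -> f' w = f w - (w \in X)) -> sdn C f') ->
  sd3 (star C X v) (fun u => Z.of_nat (f u)).
Proof.
move=> vC.
have [n le_n] : exists n, #|X| <= n by exists #|X|.
elim: n X f le_n => [|n IH] X f le_n XC fv fX f0 sd.
  have X0 : X = set0 by apply/eqP; rewrite -cards_eq0 -leqn0.
  apply: (eq_sd3 (sd f f0 _)) => [w _|x y|]; [by rewrite X0 inE subn0| |by []].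
  by rewrite /star X0 !inE !andbF !orbF.
have [X0|/set0Pn[w wX]] := eqVneq X set0.
  by apply: IH => //; rewrite X0 cards0.
have wC := subsetP XC w wX.
have wv : w != v by apply: contraNneq vC => <-.
pose f1 u := if u == w then f w - 1 else f u.
apply: (@sd3_edel _ _ _ w v) => [u||]; first by have := f0 u; lia.
  by rewrite /star eqxx wX !orbT.
have sd1 : sd3 (star C (X :\ w) v) (fun u => Z.of_nat (f1 u)).
  apply: IH.
  - by move: le_n; rewrite (cardsD1 w) wX.
  - exact: subset_trans (subD1set _ _) XC.
  - by rewrite /f1 eq_sym (negbTE wv).
  - by move=> u; rewrite !inE /f1 => /andP[/negbTE ->]; apply: fX.
  - by move=> u; rewrite /f1; case: (u =P w) => _; have := f0 u; have := fX w wX; lia.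
  move=> f' f'0 f'1; apply: sd => // u uC; rewrite f'1 // !inE /f1.
  by case: eqP => [->|] //=; rewrite wX; lia.
apply: (eq_sd3 sd1) => [x y|u].
  rewrite -del_star // /del_edge; congr (_ && ~~ _); exact: orbC.
by rewrite /upd /f1 fv; case: eqP => // _; have := fX w wX; lia.
Qed.

(** Here [v] pays [f w] for each [w] in [S]. The strict inequality leaves it at least one token, and
    any excess is then dropped. *)
Lemma sdn_star_save (C X S : {set T}) v (f : T -> nat) :
  v \notin C -> X \subset C -> S \subset X -> \sum_(w in S) f w < f v ->
  (forall u, 0 < f u) ->
  sd3 (star C (X :\: S) v) (fun u => if u == v then 1%Z else Z.of_nat (f u)) ->
  sd3 (star C X v) (fun u => Z.of_nat (f u)).
Proof.
move=> vC.
have [n le_n] : exists n, #|S| <= n by exists #|S|.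
elim: n X S f le_n => [|n IH] X S f le_n XC SX sumS f0 sd.
  have S0 : S = set0 by apply/eqP; rewrite -cards_eq0 -leqn0.
  rewrite S0 setD0 in sd; apply: (sd3_lower _ sd) => u.
  by case: eqP => [->|_]; have := f0 v; lia.
have [S0|/set0Pn[w wS]] := eqVneq S set0.
  by apply: (IH X S) => //; rewrite S0 cards0.
have wX := subsetP SX w wS; have wC := subsetP XC w wX.
have wv : w != v by apply: contraNneq vC => <-.
move: sumS; rewrite (big_setD1 w wS) /= => sumS.
apply: (@sd3_edel _ _ _ v w) => [u||]; first by have := f0 u; lia.
  by rewrite /star eqxx wX !orbT.
pose f1 u := if u == v then f v - f w else f u.
have f1E u : u \in C -> f1 u = f u.
  by move=> uC; rewrite /f1; case: eqP => // uv; rewrite uv (negbTE vC) in uC.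
have sd1 : sd3 (star C (X :\ w) v) (fun u => Z.of_nat (f1 u)).
  apply: (IH _ (S :\ w)).
  - by move: le_n; rewrite (cardsD1 w) wS.
  - exact: subset_trans (subD1set _ _) XC.
  - exact: setSD.
  - rewrite (eq_bigr f); last first.
      by move=> u; rewrite !inE => /andP[_ /(subsetP SX)/(subsetP XC)/f1E].
    rewrite {1}/f1 eqxx; lia.
  - by move=> u; rewrite /f1; case: (u =P v) => _; have := f0 u; lia.
  apply: (eq_sd3 sd) => [x y|u]; last by rewrite /f1; case: eqP.
  congr (star C _ v x y); apply/setP => u; rewrite !inE.
  by case: (u =P w) => [->|] //=; rewrite wS.
apply: (eq_sd3 sd1) => [x y|u]; first by rewrite del_star.
by rewrite /upd /f1; case: eqP => // _; lia.
Qed.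

(* Deleting [v] while its neighbours in [S] are spared: [v] pays for the edges to
   [S], then drops to 1, and every other neighbour pays 1. *)
Lemma sdn_delete (C S : {set T}) v (f : T -> nat) :
  v \notin C -> S \subset nb v :&: C -> \sum_(w in S) f w < f v ->
  (forall u, 0 < f u) -> (forall w, w \in C -> e v w -> w \notin S -> 1 < f w) ->
  (forall f' : T -> nat, (forall u, 0 < f' u) ->
     (forall w, w \in C -> f' w = f w - (e v w && (w \notin S))) -> sdn C f') ->
  sdn (v |: C) f.
Proof.
move=> vC SN sumS f0 fN sd.
have sd1 : sd3 (star C (nb v :&: C) v) (fun u => Z.of_nat (f u)).
  apply: (sdn_star_save vC _ SN sumS f0); first exact: subsetIr.
  pose f1 u := if u == v then 1 else f u.
  have f1E u : u \in C -> f1 u = f u.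
    by move=> uC; rewrite /f1; case: eqP => // uv; rewrite uv (negbTE vC) in uC.
  have sd2 : sd3 (star C (nb v :&: C :\: S) v) (fun u => Z.of_nat (f1 u)).
    apply: sdn_star_pay => //.
    - by apply/subsetP => u; rewrite !inE => /andP[_ /andP[]].
    - by rewrite /f1 eqxx.
    - by move=> w; rewrite !inE => /andP[wS /andP[vw wC]]; rewrite f1E ?fN.
    - by move=> u; rewrite /f1; case: (u =P v).
    move=> f' f'0 f'1; apply: sd => // w wC; rewrite f'1 // f1E // !inE wC andbT.
    by rewrite andbC.
  by apply: (eq_sd3 sd2) => // u; rewrite /f1; case: eqP.
apply: (eq_sd3 sd1) => // x y; rewrite /star /restr !inE.
case: (x =P v) => [->|_]; case: (y =P v) => [->|_] /=;
  rewrite ?(negbTE vC) ?ei ?andbF ?andbT ?orbF ?orFb //=.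
- by rewrite andbC.
- by rewrite es andbC.
Qed.

(** * Token reserves and final sets *)

Definition din (D : {set T}) v := #|nb v :&: D|.
Definition ex (D : {set T}) v := #|nb v :\: D|.

Lemma din_ex D v : din D v + ex D v = #|nb v|. Proof. exact: cardsID. Qed.

Lemma din_sub (D D' : {set T}) v : D \subset D' -> din D v <= din D' v.
Proof. by move=> DD; apply/subset_leq_card/setIS. Qed.

Lemma ex_sub (D D' : {set T}) v : D \subset D' -> ex D' v <= ex D v.
Proof. by move=> DD; apply/subset_leq_card/setDS. Qed.

Lemma din_U1 (D : {set T}) v w : v \notin D -> din (v |: D) w = din D w + e w v.
Proof.
move=> vD; rewrite /din; case vw: (e w v).
  rewrite setIUr (setIidPr _) ?cardsU1 ?inE ?vw ?(negbTE vD) 1?addnC //.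
  by rewrite sub1set inE.
rewrite addn0; apply: eq_card => u; rewrite !inE.
by case: (u =P v) => [->|//]; rewrite vw.
Qed.

Lemma ex_U1 (D : {set T}) v w : v \notin D -> ex D w = ex (v |: D) w + e w v.
Proof.
by move=> vD; have := din_ex D w; have := din_ex (v |: D) w; rewrite din_U1 //; lia.
Qed.

Variables (d s : nat).
Hypothesis (deg_le : forall v, #|nb v| <= d).
Hypothesis (sd : s < d).
Local Notation k := (d - s).

Lemma ex_lt (D : {set T}) v : s < din D v -> ex D v < k.
Proof. by have := din_ex D v; have := deg_le v; lia. Qed.

(** A [rich] vertex can pay one token for every neighbour still present. A [plain] one started with
    [k] tokens and has lost at most one per deleted neighbour. Both properties persist when a
    neighbour is deleted at the price of one token. *)
Definition rich (D : {set T}) (f : T -> nat) v := din D v < f v.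
Definition plain (D : {set T}) (f : T -> nat) v := k <= f v + ex D v.

(* [C] can be finished off from every position reached by deleting its
   complement, even if only the vertices of [R] kept more tokens than neighbours. *)
Definition good (R C : {set T}) :=
  (forall v, v \in C -> v \notin R -> ex C v < k) /\
  forall f : T -> nat, (forall v, 0 < f v) ->
    (forall v, v \in C -> rich C f v || (v \notin R) && plain C f v) -> sdn C f.

Lemma good0 : good set0 set0.
Proof.
split=> [v|f f0 _]; first by rewrite inE.
by apply: sd3_edgeless => [u v|v]; [rewrite /restr inE|have := f0 v; lia].
Qed.

Lemma goodR R C : good set0 C -> good R C.
Proof.
case=> exC sdC; split=> [v vC _|f f0 fC]; first by rewrite exC ?inE.
by apply: sdC => // v /fC; rewrite inE /=; case: (rich C f v) => //= /andP[].
Qed.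

(** Delete [v] first, sparing nobody. A neighbour [w] in [C] can afford its token: it is rich, or
    else plain with [ex C w < k], and then at least two tokens are left to it. *)
Lemma good_add R C v : good R C -> v \notin C -> (v \in R) || (ex C v < k) ->
  good R (v |: C).
Proof.
move=> [exC sdC] vC hv.
have sub : C \subset v |: C by exact: subsetUr.
split=> [w|f f0 fC].
  rewrite in_setU1 => /predU1P[->|wC] wR.
    by move: hv; rewrite (negbTE wR) /=; apply: leq_ltn_trans; exact: ex_sub.
  exact: leq_ltn_trans (ex_sub _ sub) (exC w wC wR).
apply: (@sdn_delete _ set0) => //; rewrite ?big_set0 ?sub0set //.
  move=> w wC vw _; have := fC w; rewrite /rich /plain in_setU1 wC orbT => /(_ isT).
  have := din_U1 w vC; have := ex_U1 w vC; rewrite (es w v) vw => exE dinE.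
  case/orP=> [|/andP[wR]]; first lia.
  have := exC w wC wR; lia.
move=> f' f'0 f'E; apply: sdC => // w wC.
have := fC w; rewrite in_setU1 wC orbT /rich /plain f'E // inE andbT => /(_ isT).
rewrite (din_U1 w vC) (ex_U1 w vC) es.
by case: (w \in R) => /=; have := f0 w; case: (e w v) => /=; lia.
Qed.

Lemma good_addset R C (X : {set T}) : good R C ->
  (forall x, x \in X -> (x \in R) || (ex C x < k)) -> good R (C :|: X).
Proof.
have [n le_n] : exists n, #|X| <= n by exists #|X|.
elim: n C X le_n => [|n IH] C X le_n gC hX.
  have X0 : X = set0 by apply/eqP; rewrite -cards_eq0 -leqn0.
  by rewrite X0 setU0.
have [->|/set0Pn[x xX]] := eqVneq X set0; first by rewrite setU0.
have cX : #|X :\ x| <= n by move: le_n; rewrite (cardsD1 x) xX.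
have [xC|xC] := boolP (x \in C).
  have -> : C :|: X = C :|: (X :\ x).
    by apply/setP => u; rewrite !inE; case: eqP => // ->; rewrite xC.
  by apply: IH => // u; rewrite !inE => /andP[_]; apply: hX.
have -> : C :|: X = (x |: C) :|: (X :\ x).
  by apply/setP => u; rewrite !inE; case: eqP => // ->; rewrite xX orbT.
apply: IH => //; first by apply: good_add => //; exact: hX.
move=> u; rewrite !inE => /andP[_ /hX /orP[->//|uC]]; apply/orP; right.
by apply: leq_ltn_trans uC; apply/ex_sub/subsetUr.
Qed.

(* The vertices of [B] of phase [j < J] are deleted first, by increasing phase, then
   [A \ UA], then those of phase at least [J] (the set [UB]), then [UA]. A deleted
   [b] spares the vertices [u] of [UA] with [pk b u] that are not yet [rich]; such a
   [u] holds at most [cap j] tokens. *)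
Section Component.
Variables (C A B UA : {set T}) (J F : nat) (ph : T -> nat) (cap : nat -> nat) (pk : rel T).
Let UB : {set T} := [set b in B | J <= ph b].
Let B' : {set T} := [set b in B | ph b < J].
Variable tau : nat.
Hypotheses (gC : good set0 C).
Hypotheses (dAB : [disjoint A & B]) (dAC : [disjoint A & C]) (dBC : [disjoint B & C]).
Hypothesis A_indep : forall a a', a \in A -> a' \in A -> ~~ e a a'.
Hypothesis A_C : forall a, a \in A -> din C a <= s.
Hypothesis B_A : forall b, b \in B -> tau <= din A b.
Hypotheses (F_gt0 : 0 < F) (F_tau : F + s <= tau).
Hypothesis UA_A : UA \subset A.
Hypothesis A_UB : forall a, a \in A -> s < din UB a.
Hypothesis UB_UA : forall b, b \in UB -> s < din UA b.
Hypothesis UA_pk : forall u, u \in UA -> s < #|[set b in nb u :&: B' | pk b u]|.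
Hypothesis B'_pk : forall b, b \in B' -> #|[set u in nb b :&: UA | pk b u]| * cap (ph b) < F.
Hypothesis UA_rem : forall u b, u \in UA -> b \in B' -> pk b u ->
  din [set b' in B | ph b <= ph b'] u + s <= cap (ph b).

Let D0 := C :|: A :|: UB.

Let UA_B u : u \in UA -> u \notin B.
Proof. by move=> /(subsetP UA_A) uA; rewrite (disjointFr dAB). Qed.

(** The sets are added in reverse order of deletion: [UA], which is exempt as it equals [R], then
    [UB], then the rest of [A]. Each later addition has more than [s] neighbours in what is already
    there. *)
Lemma good_D0 : good UA D0.
Proof.
have g1 : good UA (C :|: UA) by apply: good_addset (goodR _ gC) _ => x ->.
have g2 : good UA (C :|: UA :|: UB).
  apply: good_addset g1 _ => x xB; apply/orP; right; apply: ex_lt.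
  by apply: leq_trans (UB_UA xB) _; apply/din_sub/subsetUr.
have g3 : good UA (C :|: UA :|: UB :|: A).
  apply: good_addset g2 _ => x xA; apply/orP; right; apply: ex_lt.
  by apply: leq_trans (A_UB xA) _; apply/din_sub/subsetUr.
suff -> : D0 = C :|: UA :|: UB :|: A by [].
apply/setP => u; rewrite /D0 !in_setU; have := subsetP UA_A u.
by case: (u \in UA) => [->//|_]; case: (u \in C); case: (u \in A); case: (u \in UB).
Qed.

(** The tokens saved for [u] so far, as long as it is not rich: one per deleted neighbour that
    picked it. [Br] is the part of [B'] still present. *)
Definition received (Br : {set T}) u := #|[set b in nb u :&: (B' :\: Br) | pk b u]|.

Lemma received_D1 (Br : {set T}) u b : Br \subset B' -> b \in Br ->
  received (Br :\ b) u = received Br u + (e u b && pk b u).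
Proof.
move=> BrB bBr; have bB := subsetP BrB b bBr; rewrite /received.
rewrite (cardsD1 b) !inE eqxx /= addnC; congr (_ + _); last first.
  by move: bB; rewrite inE => -> /=; rewrite andbT.
by apply: eq_card => x; rewrite !inE; case: (x =P b) => [->|] //=; rewrite bBr !andbF.
Qed.

Let ex_D (D : {set T}) w : D0 \subset D -> D \subset C :|: A :|: B -> w \in D -> ex D w < k.
Proof.
move=> D0D DB wD.
have := subsetP DB w wD; rewrite !in_setU => /orP[/orP[wC|wA]|wB].
- apply: leq_ltn_trans (gC.1 w wC _); last by rewrite inE.
  by apply/ex_sub/(subset_trans _ D0D); rewrite /D0 -setUA subsetUl.
- apply: ex_lt; apply: leq_trans (A_UB wA) _; apply/din_sub/(subset_trans _ D0D).
  exact: subsetUr.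
apply: ex_lt; apply: (@leq_trans tau); first lia.
apply: leq_trans (B_A wB) _; apply/din_sub/(subset_trans _ D0D).
by rewrite /D0 -setUA subsetU // subsetUl orbT.
Qed.

Lemma sdn_phases (Br : {set T}) (f : T -> nat) : Br \subset B' ->
  (forall v, 0 < f v) ->
  (forall w, w \in D0 :|: Br -> w \notin UA ->
     rich (D0 :|: Br) f w || plain (D0 :|: Br) f w) ->
  (forall u, u \in UA ->
     rich (D0 :|: Br) f u || (k + received Br u <= f u + ex (D0 :|: Br) u)) ->
  sdn (D0 :|: Br) f.
Proof.
have [n le_n] : exists n, #|Br| <= n by exists #|Br|.
elim: n Br f le_n => [|n IH] Br f le_n BrB f0 fD fU.
  have Br0 : Br = set0 by apply/eqP; rewrite -cards_eq0 -leqn0.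
  rewrite {}Br0 setU0 in fD fU *; apply: good_D0.2 => // v vD.
  have [vU|vU] := boolP (v \in UA); last by apply: fD.
  rewrite orbF; have /orP[//|] := fU v vU.
  (* With all of [B'] deleted, more than [s] saved tokens make up for starting from [k = d - s], so
     [u] is rich. *)
  rewrite /received setD0 /rich; have := UA_pk vU.
  by have := din_ex D0 v; have := deg_le v; lia.
have [Br0|/set0Pn[b0 b0B]] := eqVneq Br set0.
  by apply: IH => //; rewrite Br0 cards0.
case: (arg_minnP ph b0B) => b bBr' b_min; have {bBr'}bBr : b \in Br by [].
have bB' := subsetP BrB b bBr.
have [bB phb] : b \in B /\ ph b < J by move: bB'; rewrite inE => /andP[].
have bUA : b \notin UA by apply: contraTN bB => /UA_B.
set D := D0 :|: Br in fD fU *; set Br1 := Br :\ b; set D1 := D0 :|: Br1.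
have bD1 : b \notin D1.
  rewrite !inE eqxx (disjointFr dBC bB) (disjointFl dAB bB) bB /=.
  by rewrite leqNgt phb.
have DE : D = b |: D1.
  by apply/setP => u; rewrite !inE; case: (u =P b) => [->|] //=; rewrite bBr !orbT.
have Br1B : Br1 \subset B' by exact: subset_trans (subD1set _ _) BrB.
have B'B : B' \subset B by apply/subsetP => x; rewrite inE => /andP[].
have UBB : UB \subset B by apply/subsetP => x; rewrite inE => /andP[].
have D1B : D1 \subset C :|: A :|: B.
  rewrite subUset /D0 setUS //=; apply: subset_trans Br1B (subset_trans B'B _).
  exact: subsetUr.
have D0D1 : D0 \subset D1 by exact: subsetUl.
have UAD1 : UA \subset D1.
  by apply: subset_trans D0D1; rewrite /D0 -setUA subsetU // subsetU ?UA_A ?orbT.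
(* Its at least [tau] neighbours in [A] are all still present. A rich [b] thus has more than [tau]
   tokens and a plain one at least [tau - s]. *)
have F_b : F <= f b.
  have din_b : tau <= din D b.
    apply: leq_trans (B_A bB) _; apply: din_sub.
    by rewrite /D /D0 -!setUA subsetU // subsetUl orbT.
  have := fD b; rewrite DE setU11 bUA => /(_ isT isT); rewrite -DE /rich /plain.
  have dx := din_ex D b; have dl := deg_le b.
  by case/orP => fb; clear -dx dl fb din_b F_tau sd; lia.
(* Rich vertices need no sparing, while one that is not rich costs at most its number of remaining
   neighbours. *)
pose S := [set u in nb b :&: UA | pk b u & ~~ rich D f u].
have sumS : \sum_(u in S) f u < f b.
  apply: leq_trans F_b; apply: leq_ltn_trans (B'_pk bB').
  apply: (@leq_trans (\sum_(u in S) cap (ph b))).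
    apply: leq_sum => u; rewrite !inE => /andP[/andP[bu uU] /andP[pbu]].
    rewrite /rich -leqNgt => /leq_trans; apply.
    apply: leq_trans (UA_rem uU bB' pbu).
    (* As [A] is independent and [b] has the least phase left, the remaining neighbours of [u] lie
       in [C] or have phase at least [ph b]. *)
    apply: (@leq_trans (din ([set b' in B | ph b <= ph b'] :|: C) u)).
      rewrite /din; apply/subset_leq_card/subsetP => x.
      rewrite !inE => /andP[ux xD]; rewrite ux /=.
      have := A_indep (subsetP UA_A u uU); case/orP: xD => [/orP[/orP[->|xA]|/andP[xB xJ]]|xBr].
      - by rewrite orbT.
      - by move/(_ x xA); rewrite ux.
      - by rewrite xB (leq_trans (ltnW phb)).
      - by have := subsetP BrB x xBr; rewrite inE => /andP[->]; rewrite b_min.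
    rewrite /din setIUr; apply: leq_trans (leq_card_setU _ _) _.
    by rewrite leq_add2l; exact: A_C (subsetP UA_A u uU).
  rewrite sum_nat_const leq_mul2r; apply/orP; right.
  apply/subset_leq_card/subsetP => u; rewrite !inE.
  by move=> /andP[/andP[-> ->] /andP[-> _]].
rewrite DE; apply: (sdn_delete bD1 (S := S)) => //.
- apply/subsetP => u; rewrite inE => /andP[]; rewrite !in_setI => /andP[-> uU] _.
  exact: (subsetP UAD1).
- move=> w wD1 bw wS.
  have wD : w \in D by rewrite DE in_setU1 wD1 orbT.
  have exw := ex_D D0D1 D1B wD1.
  have := ex_U1 w bD1; have := din_U1 w bD1; rewrite -DE es bw => dE eE.
  have [wU|wU] := boolP (w \in UA).
    by have := fU w wU; rewrite /rich; case/orP => fw; clear -fw exw dE eE; lia.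
  by have := fD w wD wU; rewrite /rich /plain; case/orP => fw; clear -fw exw dE eE; lia.
move=> f' f'0 f'E; apply: IH => //.
- by move: le_n; rewrite (cardsD1 b) bBr.
- move=> w wD1 wU; have wD : w \in D by rewrite DE in_setU1 wD1 orbT.
  have := fD w wD wU; rewrite /rich /plain f'E // DE (din_U1 w bD1) (ex_U1 w bD1).
  have -> : w \in S = false by rewrite !inE (negbTE wU) !andbF.
  rewrite (es b w); have := f0 w; rewrite -/D1; case: (e w b) => /=; clear; lia.
move=> u uU; have uD1 := subsetP UAD1 u uU.
have := fU u uU; rewrite /rich /Br1 received_D1 // f'E // -/D1.
have -> : (u \in S) = [&& e b u, pk b u & ~~ rich D f u] by rewrite !inE uU andbT.
rewrite /rich (ex_U1 u bD1) DE (din_U1 u bD1) (es b u) -/D1; have := f0 u.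
case: (e u b) => /=; last by clear; lia.
by case: (pk b u) => /=; clear; lia.
Qed.

Lemma good_component : good set0 (C :|: A :|: B).
Proof.
have DE : C :|: A :|: B = D0 :|: B'.
  apply/setP => u; rewrite !inE; case: (u \in B); rewrite ?orbT ?orbF //=.
  by case: ltnP; rewrite ?orbT.
split=> [v vD _|f f0 fD].
  by apply: ex_D => //; rewrite DE subsetUl.
rewrite DE; apply: sdn_phases => // [w wD _|u uU].
  by have := fD w; rewrite DE in_set0 => /(_ wD).
have := fD u; rewrite in_set0 /= !in_setU (subsetP UA_A u uU) orbT => /(_ isT).
rewrite -DE /plain /received setDv setI0.
suff -> : [set b in set0 | pk b u] = set0 by rewrite cards0 addn0.
by apply/setP => b; rewrite !inE.
Qed.

End Component.

(** * Dense bipartite pieces outside the final set *)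

Lemma din_D1 (D : {set T}) v w : v \in D -> din D w = din (D :\ v) w + e w v.
Proof. by move=> vD; rewrite -din_U1 ?setD11 // setD1K. Qed.

Lemma sum_din (X : {set T}) y : \sum_(x in X) e x y = din X y.
Proof.
rewrite /din setIC -sum1_card [in RHS]big_mkcond [in LHS]big_mkcond /=.
by apply: eq_bigr => x _; rewrite !inE es; case: (x \in X); case: (e y x).
Qed.

(** Removing a vertex with at most [t] neighbours across lowers the right side by at most [t] and
    the left side by exactly [t], so the inequality survives and pruning stops before the sets are
    empty. *)
Lemma bipartite_core (X Y : {set T}) t : t * (#|X| + #|Y|) < \sum_(x in X) din Y x ->
  exists A B : {set T}, [/\ A \subset X, B \subset Y, A != set0,
    forall a, a \in A -> t < din B a & forall b, b \in B -> t < din A b].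
Proof.
have [n le_n] : exists n, #|X| + #|Y| <= n by exists (#|X| + #|Y|).
elim: n X Y le_n => [|n IH] X Y le_n lt_t.
  have X0 : X = set0 by apply/eqP; rewrite -cards_eq0; lia.
  by rewrite X0 big_set0 in lt_t.
have [/exists_inP[x xX lex]|/exists_inPn hX] := boolP [exists x in X, din Y x <= t].
  have cX : #|X| = #|X :\ x|.+1 by rewrite (cardsD1 x) xX.
  case: (IH (X :\ x) Y); first by lia.
    by move: lt_t; rewrite (big_setD1 x xX) /= cX; clear -lex; nia.
  move=> A [B [AX BY A0 hA hB]]; exists A, B; split=> //.
  exact: subset_trans AX (subD1set _ _).
have [/exists_inP[y yY ley]|/exists_inPn hY] := boolP [exists y in Y, din X y <= t].
  have cY : #|Y| = #|Y :\ y|.+1 by rewrite (cardsD1 y) yY.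
  case: (IH X (Y :\ y)); first by lia.
    move: lt_t; rewrite (eq_bigr (fun x => din (Y :\ y) x + e x y)); last first.
      by move=> x _; rewrite (din_D1 _ yY).
    by rewrite big_split /= sum_din cY; clear -ley; nia.
  move=> A [B [AX BY A0 hA hB]]; exists A, B; split=> //.
  exact: subset_trans BY (subD1set _ _).
exists X, Y; split=> // [|a /hX|b /hY]; rewrite -?ltnNge //.
by apply: contraTneq lt_t => ->; rewrite big_set0.
Qed.

(** Enlarge [C] by single vertices while possible. When stuck, all outside vertices have at least
    [k > r * t] outside neighbours; some colour class then carries more than [t * #|~: C|] of the
    degree sum, and a core between it and the other outside vertices is added to [C]. *)
Lemma good_setT (r t : nat) (col : T -> 'I_r) :
  (forall u v, e u v -> col u != col v) -> r * t < k ->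
  (forall C A B : {set T}, good set0 C ->
     [disjoint A & B] -> [disjoint A & C] -> [disjoint B & C] ->
     (forall a a', a \in A -> a' \in A -> ~~ e a a') ->
     (forall a, a \in A -> din C a <= s) ->
     (forall a, a \in A -> t < din B a) -> (forall b, b \in B -> t < din A b) ->
     good set0 (C :|: A :|: B)) ->
  good set0 setT.
Proof.
move=> colP rt comp.
suff H n : forall C, #|~: C| <= n -> good set0 C -> good set0 setT.
  by apply: (H _ set0 (leqnn _)); exact: good0.
elim: n => [|n IH] C le_n gC.
  suff <- : C = setT by [].
  by rewrite -[C]setCK -setC0; congr (~: _); apply/eqP; rewrite -cards_eq0 -leqn0.
have [/exists_inP[v vC exv]|/exists_inPn exC] := boolP [exists v in ~: C, ex C v < k].
  rewrite in_setC in vC; apply: (IH (v |: C)); last by apply: good_add; rewrite ?exv ?orbT.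
  by move: le_n; rewrite setCU setIC -setDE (cardsD1 v (~: C)) in_setC vC.
have [WC0|W0] := eqVneq (~: C) set0; first by apply: (IH C) => //; rewrite WC0 cards0.
have dinW v : v \in ~: C -> k <= din (~: C) v.
  by move=> /exC; rewrite -leqNgt /ex /din setDE.
have : r * t * #|~: C| < \sum_(v in ~: C) din (~: C) v.
  apply: (@leq_trans (\sum_(v in ~: C) k)); last by apply: leq_sum => v /dinW.
  by rewrite sum_nat_const mulnC ltn_pmul2l // card_gt0.
rewrite (partition_big col xpredT) //= => lt_sum.
have [i lt_i] : exists i, t * #|~: C| < \sum_(v in ~: C | col v == i) din (~: C) v.
  apply/existsP; apply: contraTT lt_sum => /existsPn le_i; rewrite -leqNgt.
  apply: (@leq_trans (\sum_(i < r) t * #|~: C|)); last first.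
    by rewrite sum_nat_const card_ord mulnA.
  by apply: leq_sum => i _; have := le_i i; rewrite -leqNgt.
pose X := [set v in ~: C | col v == i]; pose Y := ~: C :\: X.
have XW : X \subset ~: C by apply/subsetP => v; rewrite inE => /andP[].
have cXY : #|X| + #|Y| = #|~: C| by rewrite -(cardsID X (~: C)) (setIidPr XW).
have X_indep u v : u \in X -> v \in X -> ~~ e u v.
  rewrite !inE => /andP[_ /eqP ui] /andP[_ /eqP vi].
  by apply/negP => /colP; rewrite ui vi eqxx.
have dinX x : x \in X -> din (~: C) x = din Y x.
  move=> xX; apply: eq_card => u; rewrite in_setI in_setI in_setD.
  case xu: (u \in nb x) => //=; suff -> : u \notin X by [].
  by apply: contraTN xu => uX; rewrite inE X_indep.
have [|A [B [AX BY A0 hA hB]]] := @bipartite_core X Y t.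
  rewrite cXY; move: lt_i; rewrite (eq_bigl (fun v => v \in X)); last first.
    by move=> v; rewrite [in RHS]inE.
  by rewrite (eq_bigr _ dinX).
have dWC (D : {set T}) : D \subset ~: C -> [disjoint D & C] by rewrite subsets_disjoint setCK.
have AC := subset_trans AX XW.
have BC : B \subset ~: C by exact: subset_trans BY (subsetDl _ _).
apply: (IH (C :|: A :|: B)).
  rewrite -ltnS; apply: leq_trans le_n; apply: proper_card.
  rewrite properC -setUA properUl // subUset negb_and.
  case/set0Pn: A0 => a aA; apply/orP; left; apply/subsetPn; exists a => //.
  by have := subsetP AC a aA; rewrite inE.
apply: comp => //; rewrite ?dWC //.
- rewrite disjoint_sym; apply: disjointWl BY _; apply: disjointWr AX _.
  by rewrite disjoints_subset /Y setDE subsetIr.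
- by move=> a a' aA aA'; apply: X_indep; exact: (subsetP AX).
(* At least [k = d - s] of the at most [d] neighbours lie outside [C]. *)
move=> a aA; have aW := subsetP AC a aA.
by have := dinW a aW; have := din_ex C a; have := deg_le a; rewrite /ex /din setDE; lia.
Qed.

End Degenerate.

Import Order.TTheory GRing.Theory Num.Theory.
Local Delimit Scope ring_scope with ring.

(** * Uniform product spaces: local lemma and tail bounds *)

Section LocalLemmaArith.
Local Open Scope ring_scope.
Variable R : realFieldType.
Implicit Types p x y z g b : R.

Lemma lll_arith_pos p dg x b g : 0 <= p -> 1 <= dg -> 4 * p * dg <= 1 ->
  0 < x -> b <= 2 * p * x -> x = b + g -> 0 < g.
Proof.
move=> p0 dg1 pd x0 hb xE.
have p4 : 4 * p <= 1 by apply: le_trans pd; rewrite ler_peMr ?mulr_ge0.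
have := ler_wpM2r (ltW x0) p4; lra.
Qed.

(** In use, [x] is the probability of avoiding the independent events, [b] the part where some
    dependent event fails, [z] the probability of avoiding all, and [y] that of the new bad event.
    As [b] is at most [x / 2], conditioning at most doubles [p]. *)
Lemma lll_arith_step p dg x b g y z : 0 <= p -> 4 * p * dg <= 1 -> 0 < x ->
  b <= dg * (2 * p * x) -> x = b + g -> g <= z -> y <= p * x -> y <= 2 * p * z.
Proof.
move=> p0 pd x0 hb xE gz yx.
have xz : x <= 2 * z by move: (ler_wpM2r (ltW x0) pd); lra.
by have := ler_wpM2l p0 xz; lra.
Qed.

(** A Bernoulli-type induction on [(1 + y) ^+ h * (1 - h%:R * y) <= 1] replaces the exponential
    function. *)
Lemma exprD1_le2 y (h : nat) : 0 <= y -> h%:R * y = 2^-1 -> (1 + y) ^+ h <= 2.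
Proof.
move=> y0 hy; suff : (1 + y) ^+ h * (1 - h%:R * y) <= 1 by rewrite hy; lra.
elim: h {hy} => [|h IH]; first by rewrite expr0 mul0r; lra.
apply: le_trans IH; rewrite exprSr -mulrA ler_wpM2l ?exprn_ge0 ?addr_ge0 //.
have hy2 : 0 <= h%:R * (y * y) by rewrite mulr_ge0 ?ler0n ?mulr_ge0.
have y2 : 0 <= y * y by rewrite mulr_ge0.
by rewrite -natr1; lra.
Qed.

Lemma exprB1_le y (h : nat) : 0 <= y <= 1 -> h%:R * y = 1 -> (1 - y) ^+ h <= 2^-1.
Proof.
move=> /andP[y0 y1] hy; suff : (1 - y) ^+ h * (1 + h%:R * y) <= 1 by rewrite hy; lra.
elim: h {hy} => [|h IH]; first by rewrite expr0 mul0r; lra.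
apply: le_trans IH; rewrite exprSr -mulrA ler_wpM2l ?exprn_ge0 ?subr_ge0 //.
have hy2 : 0 <= h%:R * (y * y) by rewrite mulr_ge0 ?ler0n ?mulr_ge0.
have y2 : 0 <= y * y by rewrite mulr_ge0.
by rewrite -natr1; lra.
Qed.
End LocalLemmaArith.

Section Probability.
Local Open Scope ring_scope.
Variables (T Omega : finType).
Hypothesis Omega_gt0 : (0 < #|Omega|)%nat.
Local Notation om := {ffun T -> Omega}.
Implicit Types (E F : pred om) (D : {set T}) (w : om).

Definition Pr E : rat := #|E|%:R / #|{: om}|%:R.

Lemma om_gt0 : 0 < #|{: om}|%:R :> rat.
Proof. by rewrite ltr0n card_ffun expn_gt0 Omega_gt0. Qed.

Lemma Pr_ge0 E : 0 <= Pr E.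
Proof. by rewrite divr_ge0 ?ler0n. Qed.

Lemma eq_Pr E F : E =1 F -> Pr E = Pr F.
Proof. by move=> EF; congr (_%:R / _); apply: eq_card => w; rewrite !unfold_in EF. Qed.

Lemma Pr_sub E F : (forall w, E w -> F w) -> Pr E <= Pr F.
Proof.
move=> EF; rewrite ler_pM2r ?invr_gt0 ?om_gt0 // ler_nat.
by apply/subset_leq_card/subsetP => w; apply: EF.
Qed.

Lemma Pr_split E F : Pr E = Pr [pred w | E w && F w] + Pr [pred w | E w && ~~ F w].
Proof.
rewrite -mulrDl -natrD; congr (_%:R / _).
rewrite -(cardID F E); congr (_ + _)%nat; apply: eq_card => w; rewrite !inE //.
by rewrite andbC.
Qed.

Lemma Pr_exists (I : finType) (A : {set I}) (Ev : I -> pred om) (G : pred om) :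
  Pr [pred w | [exists i in A, Ev i w] && G w] <=
    \sum_(i in A) Pr [pred w | Ev i w && G w].
Proof.
rewrite -mulr_suml ler_pM2r ?invr_gt0 ?om_gt0 // -natr_sum ler_nat.
rewrite -sum1_card.
under [leqRHS]eq_bigr do rewrite -sum1_card big_mkcond.
rewrite exchange_big /= [leqLHS]big_mkcond leq_sum // => w _.
rewrite unfold_in /=; case: ifP => // /andP[/exists_inP[i iA Ei] Gw].
by rewrite (bigD1 i) //= unfold_in /= Ei Gw.
Qed.

Definition depends D E := forall w w', {in D, w =1 w'} -> E w = E w'.

Definition mix D (p : om * om) : om * om :=
  ([ffun i => if i \in D then p.1 i else p.2 i],
   [ffun i => if i \in D then p.2 i else p.1 i]).

Lemma mixK D : involutive (mix D).
Proof.
by case=> w w'; congr pair; apply/ffunP => i; rewrite !ffunE /=; case: (i \in D).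
Qed.

(* Exchanging the coordinates outside [D] of two independent samples preserves
   the uniform measure and turns [E w /\ F w'] into an event on one sample. *)
Lemma Pr_indep D E F : depends D E -> depends (~: D) F ->
  Pr [pred w | E w && F w] = Pr E * Pr F.
Proof.
move=> dE dF.
have cardE : (#|[pred w | E w && F w]| * #|{: om}| = #|E| * #|F|)%nat.
  rewrite -!cardX -!sum1_card (reindex_inj (inv_inj (mixK D))) /=.
  apply: eq_bigl => -[w w']; rewrite !inE andbT !unfold_in /=; congr (_ && _).
    by apply: dE => i iD; rewrite ffunE iD.
  by apply: dF => i; rewrite in_setC ffunE => /negbTE ->.
rewrite /Pr mulf_div -natrM -cardE natrM -mulf_div divff ?mulr1 //.
by rewrite lt0r_neq0 // om_gt0.
Qed.

(** * Symmetric Lovasz local lemma *)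

Section LocalLemma.
Variables (I : finType) (Bad : I -> pred om) (D : I -> {set T}) (p : rat) (deg : nat).
Hypothesis Bad_dep : forall i, depends (D i) (Bad i).
Hypothesis Bad_le : forall i, Pr (Bad i) <= p.
Hypothesis D_deg : forall i, (#|[set j | ~~ [disjoint D i & D j]]| <= deg)%nat.
Hypotheses (deg_gt0 : (0 < deg)%nat) (p_deg : 4 * p * deg%:R <= 1).

Definition avoid (S : {set I}) : pred om := [pred w | [forall i in S, ~~ Bad i w]].

Lemma avoid_dep (S : {set I}) (A : {set T}) :
  (forall i, i \in S -> D i \subset A) -> depends A (avoid S).
Proof.
move=> SA w w' ww'; apply: eq_forallb_in => i iS; congr (~~ _).
by apply: Bad_dep => x xD; apply: ww'; apply: (subsetP (SA i iS)).
Qed.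

(** The conditional probability of [Bad i] given [avoid S] is at most [2 * p], stated without
    division because positivity of the condition is part of the same induction. *)
Lemma lll_step n (S : {set I}) : (#|S| <= n)%nat ->
  0 < Pr (avoid S) /\
  forall i, Pr [pred w | Bad i w && avoid S w] <= 2 * p * Pr (avoid S).
Proof.
have p_ge0 (i : I) : 0 <= p by exact: le_trans (Pr_ge0 _) (Bad_le i).
have step (S' : {set I}) i : 0 < Pr (avoid S') ->
    Pr [pred w | Bad i w && avoid S' w] <= 2 * p * Pr (avoid S') ->
    0 < Pr (avoid (i |: S')).
  move=> pos le_i.
  have -> : Pr (avoid (i |: S')) = Pr [pred w | avoid S' w && ~~ Bad i w].
    apply: eq_Pr => w; rewrite /= andbC; apply/forall_inP/andP => [h|[hi /forall_inP h] j].
      split; first by apply: h; rewrite setU11.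
      by apply/forall_inP => j jS; apply: h; rewrite in_setU1 jS orbT.
    by rewrite in_setU1 => /predU1P[->|/h].
  have := Pr_split (avoid S') (Bad i).
  rewrite (@eq_Pr [pred w | avoid S' w && Bad i w] [pred w | Bad i w && avoid S' w]); last first.
    by move=> w /=; rewrite andbC.
  have deg1 : 1 <= deg%:R :> rat by rewrite ler1n.
  exact: (lll_arith_pos (p_ge0 i) deg1 p_deg pos le_i).
have bound (S' : {set I}) : (forall S2 : {set I}, S2 \proper S' -> 0 < Pr (avoid S2) /\
    forall i, Pr [pred w | Bad i w && avoid S2 w] <= 2 * p * Pr (avoid S2)) ->
  forall i, Pr [pred w | Bad i w && avoid S' w] <= 2 * p * Pr (avoid S').
  move=> IHS i; pose N := [set j | ~~ [disjoint D i & D j]]; pose S2 := S' :\: N.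
  have avoid2 : depends (~: D i) (avoid S2).
    apply: avoid_dep => j.
    by rewrite !inE negbK => /andP[ij _]; rewrite -disjoints_subset disjoint_sym.
  have le2 : Pr [pred w | Bad i w && avoid S2 w] <= p * Pr (avoid S2).
    by rewrite (Pr_indep (@Bad_dep i) avoid2) ler_wpM2r // Pr_ge0.
  (* If no event of [S'] shares coordinates with [i], independence alone suffices; otherwise [S2] is
     a proper subset and induction applies to it. *)
  have [S2E|S2N] := boolP (S' \subset S2).
    have S2S : S2 = S' by apply/eqP; rewrite eqEsubset S2E subsetDl.
    move: le2; rewrite S2S => /le_trans; apply; rewrite -mulrA ler_peMl ?ler1n //.
    by rewrite mulr_ge0 ?Pr_ge0 ?(p_ge0 i).
  have [pos2 IH2] := IHS S2 (introT andP (conj (subsetDl _ _) S2N)).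
  have sub : Pr [pred w | Bad i w && avoid S' w] <= Pr [pred w | Bad i w && avoid S2 w].
    apply: Pr_sub => w /= /andP[-> /forall_inP hw]; apply/forall_inP => j.
    by rewrite !inE => /andP[_ /hw].
  have sp := Pr_split (avoid S2) (fun w => [exists j in S' :&: N, Bad j w]).
  have good2 : Pr [pred w | avoid S2 w && ~~ [exists j in S' :&: N, Bad j w]] <= Pr (avoid S').
    apply: Pr_sub => w /= /andP[/forall_inP h2 /exists_inPn h1]; apply/forall_inP => j jS.
    have [jN|jN] := boolP (j \in N); first by apply: h1; rewrite inE jS.
    by apply: h2; rewrite inE jN.
  have bad2 : Pr [pred w | avoid S2 w && [exists j in S' :&: N, Bad j w]] <=
      deg%:R * (2 * p * Pr (avoid S2)).
    rewrite (@eq_Pr _ [pred w | [exists j in S' :&: N, Bad j w] && avoid S2 w]); last first.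
      by move=> w /=; rewrite andbC.
    apply: le_trans (Pr_exists _ _ _) _.
    apply: le_trans (ler_sum _ (fun j _ => IH2 j)) _.
    rewrite sumr_const -[leLHS]mulr_natl; apply: ler_wpM2r.
      by rewrite mulr_ge0 ?Pr_ge0 // mulr_ge0 ?(p_ge0 i).
    by rewrite ler_nat; apply: leq_trans (D_deg i); apply/subset_leq_card/subsetIr.
  apply: le_trans sub _.
  exact: (lll_arith_step (p_ge0 i) p_deg pos2 bad2 sp good2 le2).
elim: n S => [|n IH] S le_n.
  have -> : S = set0 by apply/eqP; rewrite -cards_eq0 -leqn0.
  split; last by apply: bound => S2; rewrite properE sub0set andbF.
  rewrite /Pr (@eq_card _ _ predT) ?divff ?lt0r_neq0 ?om_gt0 // => w.
  by apply/forall_inP => i; rewrite inE.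
have prop (S2 : {set I}) : S2 \proper S -> (#|S2| <= n)%nat.
  by move=> /proper_card S2S; rewrite -ltnS; exact: leq_trans S2S le_n.
split; last by apply: bound => S2 /prop; exact: IH.
have [S0|/set0Pn[i iS]] := eqVneq S set0; first by apply: (IH S _).1; rewrite S0 cards0.
have [|pos le_i] := IH (S :\ i); first by apply/prop/properD1.
by rewrite -(setD1K iS); apply: step.
Qed.

Lemma lovasz_local : exists w : om, forall i, ~~ Bad i w.
Proof.
have [pos _] := lll_step (leqnn #|[set: I]|).
have [w /forall_inP hw|no] := pickP (avoid [set: I]).
  by exists w => i; apply: hw; rewrite inE.
by move: pos; rewrite /Pr (eq_card0 no) mul0r ltxx.
Qed.

End LocalLemma.

(** * Exponential moments and tail bounds *)

Section Tails.
Variables (v : T) (S : {set T}) (h : Omega -> Omega -> bool).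
Hypothesis vS : v \notin S.

Definition hits w := #|[set u in S | h (w v) (w u)]|.

(** Given the label [x] of [v], the labels on [S] are independent and each contributes an average
    factor of at most [M]. *)
Lemma hits_mgf (b M : rat) : 0 <= b -> 0 <= M ->
  (forall x, \sum_y b ^+ h x y <= M * #|Omega|%:R) ->
  \sum_w b ^+ hits w <= M ^+ #|S| * #|{: om}|%:R.
Proof.
move=> b0 M0 hM.
(* The factor at [v] is the indicator of its label being [x]; this turns the moment into a sum of
   products over coordinates. *)
pose g x i y : rat := if i == v then (y == x)%:R else if i \in S then b ^+ h x y else 1.
have hitsE w : b ^+ hits w = \sum_x \prod_i g x i (w i).
  rewrite (bigD1 (w v)) //= [X in _ = _ + X]big1 ?addr0; last first.
    move=> x xv; rewrite (bigD1 v) //= /g eqxx eq_sym (negbTE xv) mul0r //.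
  rewrite (bigD1 v) //= {1}/g !eqxx mul1r.
  rewrite (eq_bigr (fun i => if i \in S then b ^+ h (w v) (w i) else 1)); last first.
    by move=> i iv; rewrite /g (negbTE iv).
  rewrite -big_mkcondr /= (eq_bigl (fun i => i \in S)); last first.
    by move=> i; rewrite andbC; case: (i =P v) => [->|]; rewrite ?andbT ?(negbTE vS).
  rewrite prodrXr; congr (_ ^+ _).
  rewrite /hits -sum1_card big_mkcond [RHS]big_mkcond; apply: eq_bigr => i _.
  by rewrite inE; case: (i \in S) => //=; case: (h _ _).
under eq_bigr do rewrite hitsE.
rewrite exchange_big /=.
under eq_bigr do rewrite -bigA_distr_bigA.
pose G i : rat := if i == v then 1 else if i \in S then M * #|Omega|%:R else #|Omega|%:R.
apply: (@le_trans _ _ (\sum_(x in Omega) \prod_i G i)).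
  apply: ler_sum => x _; apply: ler_prod => i _; rewrite /g /G.
  apply/andP; split.
    by apply: sumr_ge0 => y _; case: ifP => // _; case: ifP => // _; rewrite exprn_ge0.
  case: ifP => _; last by case: ifP => // _; rewrite sumr_const.
  by rewrite (bigD1 x) //= eqxx big1 ?addr0 // => y /negbTE ->.
have -> : M ^+ #|S| * #|{: om}|%:R =
    \prod_i (if i \in S then M else 1) * \prod_(i in T) #|Omega|%:R.
  by rewrite -big_mkcond /= prodr_const prodr_const card_ffun natrX.
rewrite sumr_const -[leLHS]mulr_natr (bigD1 v) //= {1}/G eqxx mul1r mulrC -big_split /=.
rewrite [leRHS](bigD1 v) //= (negbTE vS) mul1r.
rewrite (eq_bigr (fun i => (if i \in S then M else 1) * #|Omega|%:R)) => [|i iv].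
  exact: lexx.
by rewrite /G (negbTE iv); case: ifP => // _; rewrite mul1r.
Qed.

Lemma Pr_markov E (X : om -> rat) (b c : rat) : 0 < c -> (forall w, 0 <= X w) ->
  (forall w, E w -> c <= X w) -> \sum_w X w <= b * #|{: om}|%:R -> Pr E <= b / c.
Proof.
move=> c0 X0 XE Xb; rewrite ler_pdivlMr // mulrAC ler_pdivrMr ?om_gt0 //.
apply: le_trans Xb; rewrite -sum1_card natr_sum mulr_suml.
rewrite [leLHS]big_mkcond; apply: ler_sum => w _.
by case: ifP => // /XE; rewrite mul1r.
Qed.

(** The mean is at most [2 ^ (n - q)] and the threshold is four times that. With
    [a = 2 ^ (n - q + 1)], the moment with base 2 is at most [2 ^+ a], and Markov divides it by
    [2 ^+ (a + a)]. *)
Lemma hits_ge (n q : nat) : (0 < q <= n)%nat -> (#|S| <= 2 ^ n)%nat ->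
  (forall x, #|[pred y | h x y]| * 2 ^ q <= #|Omega|)%nat ->
  Pr [pred w | (2 ^ (n - q + 2) <= hits w)%nat] <= 2^-1 ^+ (2 ^ (n - q + 1)).
Proof.
move=> /andP[q0 qn] Sn hq; pose y : rat := 2^-1 ^+ q; pose a := (2 ^ (n - q + 1))%nat.
have y0 : 0 <= y by rewrite exprn_ge0.
have M1 : 1 <= 1 + y by rewrite lerDl.
have M_le2 : (1 + y) ^+ (2 ^ q.-1) <= 2.
  apply: exprD1_le2 => //; rewrite natrX /y -[in 2^-1 ^+ q](prednK q0) exprS mulrCA -exprMn.
  by rewrite mulfV ?expr1n ?mulr1.
have M_le : (1 + y) ^+ #|S| <= 2 ^+ a.
  apply: (@le_trans _ _ ((1 + y) ^+ (2 ^ n))); first by rewrite ler_weXn2l.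
  have -> : (2 ^ n = 2 ^ q.-1 * a)%nat by rewrite /a -expnD; congr expn; lia.
  by rewrite exprM lerXn2r // ?nnegrE ?exprn_ge0 //; lra.
apply: (@le_trans _ _ (2 ^+ a / 2 ^+ (2 ^ (n - q + 2)))).
  apply: (@Pr_markov _ (fun w => 2 ^+ hits w)) => [||w /=|].
  - by rewrite exprn_gt0.
  - by move=> w; rewrite exprn_ge0.
  - by move=> hw; rewrite ler_eXn2l // ler1n.
  apply: le_trans (@hits_mgf 2 (1 + y) _ _ _) _; last first.
  - exact: ler_wpM2r M_le.
  - move=> x; rewrite mulrDl mul1r.
    rewrite (eq_bigr (fun z => 1 + (h x z)%:R)); last first.
      by move=> z _; case: (h x z); rewrite ?expr1 ?expr0.
    rewrite big_split /= sumr_const lerD2l -natr_sum -big_mkcond sum1_card.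
    rewrite /y exprVn mulrC ler_pdivlMr ?exprn_gt0 // -natrX -natrM ler_nat.
    exact: hq.
  - by lra.
  - by [].
have -> : (2 ^ (n - q + 2) = a + a)%nat by rewrite /a addnn -mul2n -expnS; congr expn; lia.
by rewrite exprD invfM mulrA mulfV ?mul1r ?exprVn // expf_neq0.
Qed.

(** The mean is at least four times the threshold [a = 2 ^ e]. The moment with base 1/2 is at most
    [2^-1 ^+ (a + a)], and Markov gives back one factor [2^-1 ^+ a]. *)
Lemma hits_lt (e q : nat) : (2 ^ (e + q + 2) <= #|S|)%nat ->
  (forall x, #|Omega| <= #|[pred y | h x y]| * 2 ^ q)%nat ->
  Pr [pred w | (hits w < 2 ^ e)%nat] <= 2^-1 ^+ (2 ^ e).
Proof.
move=> Sn hq; pose y : rat := 2^-1 ^+ q.+1; pose a := (2 ^ e)%nat.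
have y0 : 0 <= y by rewrite exprn_ge0.
have y1 : y <= 1 by rewrite exprn_ile1 //; lra.
have M_le1 : (1 - y) ^+ (2 ^ q.+1) <= 2^-1.
  apply: exprB1_le; first by rewrite y0.
  by rewrite natrX /y -exprMn mulfV ?expr1n.
have M_le : (1 - y) ^+ #|S| <= 2^-1 ^+ (a + a).
  apply: (@le_trans _ _ ((1 - y) ^+ (2 ^ (e + q + 2)))).
    by rewrite ler_wiXn2l // ?subr_ge0 ?gerBl.
  have -> : (2 ^ (e + q + 2) = 2 ^ q.+1 * (a + a))%nat.
    by rewrite /a addnn -mul2n -expnS -expnD; congr expn; lia.
  by rewrite exprM lerXn2r // ?nnegrE ?exprn_ge0 ?subr_ge0 //; lra.
apply: (@le_trans _ _ (2^-1 ^+ (a + a) / 2^-1 ^+ a)).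
  apply: (@Pr_markov _ (fun w => 2^-1 ^+ hits w)) => [||w /=|].
  - by rewrite exprn_gt0 // invr_gt0.
  - by move=> w; rewrite exprn_ge0.
  - by move=> /ltnW hw; rewrite ler_wiXn2l //; lra.
  apply: le_trans (@hits_mgf 2^-1 (1 - y) _ _ _) _; last first.
  - exact: ler_wpM2r M_le.
  - move=> x; rewrite mulrBl mul1r.
    rewrite (eq_bigr (fun z => 1 - 2^-1 * (h x z)%:R)); last first.
      by move=> z _; case: (h x z); rewrite /= ?expr1 ?expr0 ?mulr1 ?mulr0 ?subr0 //; lra.
    rewrite sumrB sumr_const lerD2l lerN2 -mulr_sumr -natr_sum -big_mkcond sum1_card.
    rewrite /y exprS -mulrA ler_wpM2l // exprVn mulrC ler_pdivrMr ?exprn_gt0 //.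
    rewrite -natrX -natrM ler_nat; exact: hq.
  - by rewrite subr_ge0.
  - by [].
by rewrite exprD mulfK // expf_neq0 // invr_neq0.
Qed.

End Tails.
End Probability.

(** * Random phases *)

Lemma card_ord_mod a b c : 0 < b -> #|[pred y : 'I_(a * b) | y == c %[mod b]]| = a.
Proof.
move=> b0; rewrite -sum1_card big_mkcond /=.
rewrite (eq_bigr (fun y : 'I_(a * b) => (y %% b == c %% b) : nat)); last first.
  by move=> y _; rewrite inE; case: eqP.
rewrite -(big_mkord xpredT (fun y => (y %% b == c %% b) : nat)).
elim: a => [|a IH]; first by rewrite big_geq.
rewrite mulSn addnC (@big_cat_nat _ _ _ (a * b)) ?leq_addr //= IH.
rewrite -{1}[a * b]add0n big_addn addnC addKn.
rewrite (eq_big_nat _ _ (F2 := fun i => (i == c %% b) : nat)); last first.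
  by move=> i /andP[_ ib]; rewrite addnC modnMDl modn_small.
rewrite -big_mkcond big_nat1_eq ltn_mod b0 //=; lia.
Qed.

Lemma card_pow2_mod m j c : j <= m -> #|[pred y : 'I_(2 ^ m) | y == c %[mod 2 ^ j]]| = 2 ^ (m - j).
Proof.
move=> jm; rewrite -[RHS](@card_ord_mod _ (2 ^ j) c) ?expn_gt0 //.
by rewrite -expnD subnK.
Qed.

Section Phase.
Variable n : nat.

(* The 2-adic valuation of [y], with value [n] at [y = 0]. *)
Definition phase (y : 'I_(2 ^ n)) := logn 2 (y + 2 ^ n).

Lemma le_phase j y : j <= n -> (j <= phase y) = (2 ^ j %| y).
Proof.
move=> jn; rewrite /phase -pfactor_dvdn ?addn_gt0 ?expn_gt0 ?orbT //.
by rewrite dvdn_addl // dvdn_exp2l.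
Qed.

Lemma card_le_phase j : j <= n -> #|[pred y | j <= phase y]| = 2 ^ (n - j).
Proof.
move=> jn; rewrite -(@card_pow2_mod n j 0 jn); apply: eq_card => y.
by rewrite !inE le_phase // mod0n.
Qed.

Lemma card_phase j : j < n -> #|[pred y | phase y == j]| = 2 ^ (n - j.+1).
Proof.
move=> jn; have := card_le_phase (ltnW jn).
rewrite -(cardID [pred y | j.+1 <= phase y]).
rewrite (eq_card (B := [pred y | j.+1 <= phase y])); last first.
  by move=> y; rewrite !inE; case: ltngtP.
rewrite card_le_phase // (eq_card (B := [pred y | phase y == j])); last first.
  by move=> y; rewrite !inE -leqNgt eqn_leq.
by rewrite -(subnSK jn) expnS mul2n -addnn => /addnI.
Qed.
End Phase.

Section Sample.
Variables (n K J j0 : nat).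
Hypotheses (Jn : J <= n) (JK : J <= K).
Definition label := ('I_(2 ^ n) * 'I_(2 ^ K))%type.

Definition picks (b a : label) : bool :=
  (j0 <= phase b.1) && (b.2 == a.2 %[mod 2 ^ (K - phase b.1)]).

Lemma card_label : #|{: label}| = 2 ^ (n + K).
Proof. by rewrite card_prod !card_ord expnD. Qed.

Lemma label_gt0 : 0 < #|{: label}|.
Proof. by rewrite card_label expn_gt0. Qed.

Lemma card_label_phase j : j <= n ->
  #|[pred y : label | j <= phase y.1]| * 2 ^ j = #|{: label}|.
Proof.
move=> jn.
rewrite (eq_card (B := [predX [pred y | j <= phase (y : 'I_(2 ^ n))] & predT])); last first.
  by move=> y; rewrite !inE andbT.
rewrite cardX card_le_phase // card_ord card_label mulnAC -expnD subnK // expnD //.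
Qed.

Lemma card_label_picked x (b : label) j : x <= n -> j < J ->
  #|[pred a : label | (phase b.1 == j) && (x <= phase a.1) && picks b a]| * 2 ^ (x + K - j)
    <= #|{: label}|.
Proof.
move=> xn jJ; have [bj|bj] := eqVneq (phase b.1) j; last first.
  by rewrite (eq_card0 (A := _)) // => a; rewrite !inE.
apply: (@leq_trans (#|[predX [pred y | x <= phase (y : 'I_(2 ^ n))]
   & [pred z : 'I_(2 ^ K) | z == b.2 %[mod 2 ^ (K - j)]]]| * 2 ^ (x + K - j))).
  rewrite leq_mul2r; apply/orP; right; apply/subset_leq_card/subsetP => a.
  by rewrite !inE /picks bj => /andP[/= -> /andP[_]]; rewrite eq_sym.
rewrite cardX card_le_phase // card_pow2_mod ?leq_subr // card_label.
by rewrite -!expnD leq_exp2l //; lia.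
Qed.

(** Phase [j] has probability [2 ^ -(j + 1)] and picks [a] with probability [2 ^ (j - K)]; the
    product does not depend on [j], so all [J - j0] active phases contribute equally. *)
Lemma card_label_picking (a : label) :
  #|[pred b : label | (phase b.1 < J) && picks b a]| = (J - j0) * 2 ^ n.-1.
Proof.
have [J0|J_gt0] := posnP J.
  by rewrite J0 sub0n mul0n eq_card0.
rewrite -sum1_card big_mkcond /=.
rewrite -(pair_bigA _ (fun y z =>
  if (y, z) \in [pred b : label | (phase b.1 < J) && picks b a] then 1 else 0)) /=.
rewrite (eq_bigr (fun y : 'I_(2 ^ n) => \sum_(j0 <= j < J | j == phase y) 2 ^ j)); last first.
  move=> y _; rewrite big_nat1_eq -big_mkcond sum1_card.
  case: ifP => yJ; last first.
    rewrite eq_card0 // => z; rewrite !inE /picks unfold_in /=.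
    by rewrite andbA [_ && (j0 <= _)]andbC yJ.
  have [jy Jy] := andP yJ; have yK := leq_trans (ltnW Jy) JK.
  rewrite -[in RHS](subKn yK) -(@card_pow2_mod K _ a.2) ?leq_subr //.
  by apply: eq_card => z; rewrite !inE /picks unfold_in /= jy Jy.
under eq_bigr do rewrite big_mkcond.
rewrite exchange_big /= (eq_big_nat _ _ (F2 := fun _ => 2 ^ n.-1)) ?sum_nat_const_nat //.
move=> j /andP[_ jJ]; have jn : j < n by exact: leq_trans jJ Jn.
rewrite -big_mkcond sum_nat_const (eq_card (B := [pred y : 'I_(2 ^ n) | phase y == j])); last first.
  by move=> y; rewrite !inE eq_sym.
by rewrite card_phase // -expnD; congr expn; lia.
Qed.
End Sample.

Lemma card_bigcup_le (T I : finType) (S : {set I}) (F : I -> {set T}) m :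
  (forall i, i \in S -> #|F i| <= m) -> #|\bigcup_(i in S) F i| <= #|S| * m.
Proof.
move=> Fm; rewrite -sum_nat_const; apply: (@leq_trans (\sum_(i in S) #|F i|)); last exact: leq_sum.
elim/big_rec2: _ => [|i A k _ Ak]; first by rewrite cards0.
by apply: leq_trans (leq_card_setU _ _) _; rewrite leq_add2l.
Qed.

Lemma hits_dep (T Omega : finType) (v : T) (S D : {set T}) (h : Omega -> Omega -> bool)
    (w w' : {ffun T -> Omega}) :
  v \in D -> S \subset D -> {in D, w =1 w'} -> hits v S h w = hits v S h w'.
Proof.
move=> vD SD ww'; apply: eq_card => u; rewrite !inE.
by case uS: (u \in S) => //=; rewrite !ww' // (subsetP SD).
Qed.

(** * Choosing the labels by the local lemma *)

Section RandomComponent.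
Variables (T : finType) (e : rel T).
Hypotheses (es : symmetric e) (ei : irreflexive e).
Variables (d s n l x J rho : nat).
Hypothesis deg_le : forall v, #|nb e v| <= d.
Hypotheses (sd : s < d) (dn : d <= 2 ^ n) (nl : n < 2 ^ l.+1).
Hypotheses (x_bounds : 2 * x + l <= n <= 2 * x + l + 1) (J_bounds : 4 * J <= n <= 4 * J + 3).
Hypotheses (n_big : 64 * (l + rho + 20) <= n) (l_gt : 20 <= l).
(** From phase [j0] on, the expected number of picks is large enough to concentrate; earlier phases
    pick nothing. [K] is tuned so that the bound on the picks in phase [j] times the cap
    [2 ^ (n - j + 3)] equals [2 ^ (n - rho - 1)], the tokens a deleted vertex can spend. [s] is half
    the number of picks that each vertex of [UA] is sure to receive. *)
Let j0 := rho + l + 9.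
Let K := n - x + rho + 6.
Hypotheses (J_j0 : 2 ^ (l - 3) <= J - j0) (sE : s = 2 ^ (x + l - 2 * rho - 13)).
Variables (A B : {set T}).
Hypotheses (degA : forall a, a \in A -> 2 ^ (n - rho) < din e B a)
  (degB : forall b, b \in B -> 2 ^ (n - rho) < din e A b).

Local Notation Label := (label n K).
Local Notation pk := (picks (n := n) (K := K) j0).

(* The label of [a] in [A] decides [a \in UA] by [x <= phase a.1]; that of [b] in [B]
   gives its phase. A vertex of phase [j] picks the [a] whose second coordinate
   agrees with its own modulo [2 ^ (K - j)], so that it picks about [2 ^ j / 2 ^ K]
   of its neighbours in [UA] and yet every pick depends on two labels only. *)
Definition constraint := ('I_n + 'I_n + option bool)%type.

(** In order, the failures of five hypotheses of [good_component]: [UA_rem], [B'_pk], [A_UB],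
    [UA_pk] and [UB_UA]. *)
Definition violated (vc : T * constraint) (w : {ffun T -> Label}) : bool :=
  let v := vc.1 in
  match vc.2 with
  | inl (inl j) => [&& v \in A, 0 < j, j < J &
      2 ^ (n - j + 2) <= hits v (nb e v :&: B) (fun _ b => j <= phase b.1) w]
  | inl (inr j) => [&& v \in B, j0 <= j, j < J &
      2 ^ (n - (x + K - j) + 2) <= hits v (nb e v :&: A)
        (fun b a => (phase b.1 == j) && (x <= phase a.1) && pk b a) w]
  | inr None => (v \in A) &&
      (hits v (nb e v :&: B) (fun _ b => J <= phase b.1) w < 2 ^ (n - rho - J - 2))
  | inr (Some true) => (v \in A) &&
      (hits v (nb e v :&: B) (fun a b => (phase b.1 < J) && pk b a) w < 2 ^ (x + l - 2 * rho - 12))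
  | inr (Some false) => (v \in B) &&
      (hits v (nb e v :&: A) (fun _ a => x <= phase a.1) w < 2 ^ (n - rho - x - 2))
  end.

Definition nbhd v := v |: nb e v.

Lemma violated_dep vc : depends (nbhd vc.1) (violated vc).
Proof.
case: vc => v c w w' /= ww'.
have hE S h : hits v (nb e v :&: S) h w = hits v (nb e v :&: S) h w'.
  apply: (hits_dep _ _ _ ww'); first exact: setU11.
  by apply: subset_trans (subsetIl _ _) (subsetUr _ _).
by rewrite /violated /=; case: c {ww'} => [[j|j]|[[|]|]]; rewrite hE.
Qed.

(** Intersecting closed neighbourhoods have centres at distance at most two, which leaves at most
    [2 ^ n.+1 * 2 ^ n.+1] centres, each with [2 * n + 3] constraints. *)
Lemma nbhd_deg (vc : T * constraint) :
  #|[set vc' : T * constraint | ~~ [disjoint nbhd vc.1 & nbhd vc'.1]]| <= 2 ^ (3 * n + 4).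
Proof.
have nbhd_le v : #|nbhd v| <= 2 ^ n.+1.
  apply: leq_trans (leq_card_setU _ _) _; rewrite cards1 expnS mul2n -addnn.
  by rewrite leq_add ?expn_gt0 // (leq_trans (deg_le v)).
apply: (@leq_trans #|setX (\bigcup_(u in nbhd vc.1) nbhd u) [set: constraint]|).
  apply/subset_leq_card/subsetP => -[v c]; rewrite !inE /= andbT => /pred0Pn[u /= /andP[u1 u2]].
  apply/bigcupP; exists u => //; move: u2; rewrite !inE eq_sym es; exact.
rewrite cardsX cardsT; apply: (@leq_trans (2 ^ n.+1 * 2 ^ n.+1 * 2 ^ n.+2)); last first.
  by rewrite -!expnD leq_exp2l //; lia.
apply: leq_mul.
  apply: leq_trans (card_bigcup_le (m := 2 ^ n.+1) _) _ => [u _|]; first exact: nbhd_le.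
  by rewrite leq_mul2r nbhd_le orbT.
rewrite !card_sum !card_ord card_option card_bool !expnS.
have := ltn_expl n (isT : 1 < 2); lia.
Qed.

Let n_le_pow i : l + 4 <= i -> 8 * n <= 2 ^ i.
Proof.
move=> li; apply: (@leq_trans (2 ^ (l + 4))); last by rewrite leq_exp2l.
by rewrite (_ : l + 4 = 3 + l.+1) ?expnD; lia.
Qed.

(** Each tail bound has the form [2^-1 ^+ (2 ^ i)] with [l + 4 <= i], and [n < 2 ^ l.+1] gives
    [8 * n <= 2 ^ i]. *)
Lemma violated_le vc : (Pr (violated vc) <= 2^-1 ^+ (8 * n))%ring.
Proof.
have half_le (P : rat) i : l + 4 <= i -> (P <= 2^-1 ^+ (2 ^ i))%ring -> (P <= 2^-1 ^+ (8 * n))%ring.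
  move=> /n_le_pow li /le_trans; apply.
  by rewrite ler_wiXn2l.
have out (E : pred {ffun T -> Label}) : E =1 xpred0 -> (Pr E <= 2^-1 ^+ (8 * n))%ring.
  by move=> E0; rewrite /Pr eq_card0 ?mul0r ?exprn_ge0 // => w; rewrite unfold_in E0.
have L0 := label_gt0 n K.
have vN v (S : {set T}) : v \notin nb e v :&: S by rewrite !inE ei.
have Nn v (S : {set T}) : #|nb e v :&: S| <= 2 ^ n.
  by apply: leq_trans (subset_leq_card (subsetIl _ _)) _; apply: leq_trans (deg_le v) dn.
have Jn : J <= n by lia.
have JK : J <= K by rewrite /K; lia.
have xn : x <= n by lia.
case: vc => v [[j|j]|[[|]|]]; rewrite /violated /=.
- have [/and3P[vA j_gt0 jJ]|] := boolP [&& v \in A, 0 < j & j < J]; last first.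
    by move=> nE; apply: out => w; apply: contraNF nE => /and4P[-> -> ->].
  rewrite vA j_gt0 jJ /=.
  apply: (half_le _ (n - j + 1)); first lia.
  apply: hits_ge => //; first by rewrite j_gt0 ltnW.
  by move=> _; rewrite card_label_phase // ltnW.
- have [/and3P[vB j0j jJ]|] := boolP [&& v \in B, j0 <= j & j < J]; last first.
    by move=> nE; apply: out => w; apply: contraNF nE => /and4P[-> -> ->].
  rewrite vB j0j jJ /=.
  (* The exponent equals [j - rho - 5], which is at least [l + 4] exactly when [j0 <= j]. *)
  apply: (half_le _ (n - (x + K - j) + 1)); first by rewrite /K /j0 in j0j *; lia.
  apply: hits_ge => //; first by rewrite /K /j0 in j0j *; lia.
  by move=> b; apply: (card_label_picked (J := J)).
- have [vA|nE] := boolP (v \in A); last by apply: out.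
  apply: (half_le _ (x + l - 2 * rho - 12)); first lia.
  apply: (@hits_lt _ _ L0 _ _ _ (vN _ _) _ (K + 4 - l)).
    apply: leq_trans (ltnW (degA vA)); rewrite leq_exp2l // /K; lia.
  move=> a; rewrite (card_label_picking _ Jn JK) card_label.
  apply: (@leq_trans (2 ^ (l - 3) * 2 ^ n.-1 * 2 ^ (K + 4 - l))).
    by rewrite -!expnD leq_exp2l // /K; lia.
  by rewrite !leq_mul2r J_j0 !orbT.
- have [vB|nE] := boolP (v \in B); last by apply: out.
  apply: (half_le _ (n - rho - x - 2)); first lia.
  apply: (@hits_lt _ _ L0 _ _ _ (vN _ _) _ x).
    apply: leq_trans (ltnW (degB vB)); rewrite leq_exp2l //; lia.
  by move=> _; rewrite card_label_phase.
have [vA|nE] := boolP (v \in A); last by apply: out.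
apply: (half_le _ (n - rho - J - 2)); first lia.
apply: (@hits_lt _ _ L0 _ _ _ (vN _ _) _ J).
  apply: leq_trans (ltnW (degA vA)); rewrite leq_exp2l //; lia.
by move=> _; rewrite card_label_phase.
Qed.

Lemma exists_labelling : exists w : {ffun T -> Label}, forall vc, ~~ violated vc w.
Proof.
apply: (lovasz_local (label_gt0 n K) violated_dep violated_le nbhd_deg).
  by rewrite expn_gt0.
have pow_le : (2^-1 ^+ (8 * n) <= 2^-1 ^+ (2 + (3 * n + 4)) :> rat)%ring.
  rewrite ler_wiXn2l //; lia.
apply: le_trans (ler_wpM2r _ (ler_wpM2l _ pow_le)) _ => //.
rewrite exprD natrX mulrA -mulrA -exprMn mulVf // expr1n mulr1; lra.
Qed.

Lemma good_random_component (C : {set T}) : good e d s set0 C ->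
  [disjoint A & B] -> [disjoint A & C] -> [disjoint B & C] ->
  (forall a a', a \in A -> a' \in A -> ~~ e a a') ->
  (forall a, a \in A -> din e C a <= s) ->
  good e d s set0 (C :|: A :|: B).
Proof.
move=> gC dAB dAC dBC A_indep A_C; have [w ok] := exists_labelling.
have lt_nJ j : j < J -> j < n by move=> jJ; lia.
pose ph v := phase (w v).1.
pose UA := [set a in A | x <= ph a].
have s_lt i : x + l - 2 * rho - 12 <= i -> s < 2 ^ i.
  by move=> le_i; rewrite sE ltn_exp2l //; lia.
(* [F] is half of [tau], leaving room for [s]. The cap is twice the bound [2 ^ (n - j + 2)] on later
   neighbours in [B], again to absorb [s]. *)
apply: (@good_component _ _ es ei d s deg_le sd C A B UA J (2 ^ (n - rho - 1)) ph
  (fun j => 2 ^ (n - j + 3)) (fun b a => pk (w b) (w a)) (2 ^ (n - rho))) => //.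
- by move=> b /degB/ltnW.
- by rewrite expn_gt0.
- have -> : 2 ^ (n - rho) = 2 ^ (n - rho - 1) + 2 ^ (n - rho - 1).
    by rewrite addnn -mul2n -expnS; congr expn; lia.
  by rewrite leq_add2l ltnW // s_lt //; lia.
- by apply/subsetP => a; rewrite inE => /andP[].
- move=> a aA; have := ok (a, inr None); rewrite /violated /= aA -leqNgt => le_h.
  apply: leq_trans (s_lt (n - rho - J - 2) _) _; first lia.
  apply: leq_trans le_h _; apply/subset_leq_card/subsetP => b.
  by rewrite !inE => /andP[/andP[-> ->] ->].
- move=> b; rewrite inE => /andP[bB _].
  have := ok (b, inr (Some false)); rewrite /violated /= bB -leqNgt => le_h.
  apply: leq_trans (s_lt (n - rho - x - 2) _) _; first lia.
  apply: leq_trans le_h _; apply/subset_leq_card/subsetP => a.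
  by rewrite !inE => /andP[/andP[-> ->] ->].
- move=> u; rewrite inE => /andP[uA _].
  have := ok (u, inr (Some true)); rewrite /violated /= uA -leqNgt => le_h.
  apply: leq_trans (s_lt (x + l - 2 * rho - 12) _) _; first lia.
  apply: leq_trans le_h _; apply/subset_leq_card/subsetP => b.
  by rewrite !inE => /andP[/andP[-> ->] /andP[-> ->]].
- move=> b; rewrite inE => /andP[bB bJ]; have [j0b|bj0] := leqP j0 (ph b); last first.
    rewrite (_ : [set u in _ | _] = set0) ?cards0 ?mul0n ?expn_gt0 //.
    by apply/setP => u; rewrite !inE /picks [j0 <= _]leqNgt bj0 /= andbF.
  have := ok (b, inl (inr (Ordinal (lt_nJ _ bJ)))).
  rewrite /violated /= bB j0b bJ /= -ltnNge => lt_h.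
  apply: (@leq_ltn_trans (hits b (nb e b :&: A) (fun b' a =>
     (phase b'.1 == ph b) && (x <= phase a.1) && pk b' a) w * 2 ^ (n - ph b + 3))).
    rewrite leq_mul2r; apply/orP; right; apply/subset_leq_card/subsetP => u.
    by rewrite !inE => /andP[/andP[-> /andP[-> xu]] ->]; rewrite /ph eqxx [x <= _]xu.
  have -> : 2 ^ (n - rho - 1) = 2 ^ (n - (x + K - ph b) + 2) * 2 ^ (n - ph b + 3).
    by rewrite -expnD; congr expn; rewrite /K /j0 in j0b *; lia.
  by rewrite ltn_mul2r expn_gt0.
move=> u b; rewrite !inE => /andP[uA _] /andP[bB bJ] /andP[j0b _].
have := ok (u, inl (inl (Ordinal (lt_nJ _ bJ)))).
rewrite /violated /= uA bJ (leq_trans _ j0b) /= -?ltnNge => [lt_h|]; last by rewrite /j0; lia.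
have -> : 2 ^ (n - ph b + 3) = 2 ^ (n - ph b + 2) + 2 ^ (n - ph b + 2).
  by rewrite addnn -mul2n -expnS addnS.
rewrite leq_add //; last by rewrite ltnW // s_lt //; lia.
apply: leq_trans (ltnW lt_h); apply/subset_leq_card/subsetP => b'.
by rewrite !inE => /andP[-> /andP[-> ->]].
Qed.

End RandomComponent.

(** * The main theorem *)

Lemma sd3_chromatic (T : finType) (e : rel T) (d s n l x J r : nat) (col : T -> 'I_r) :
  symmetric e -> irreflexive e -> (forall v, #|nb e v| <= d) ->
  (forall u v, e u v -> col u != col v) ->
  2 ^ n.-1 < d <= 2 ^ n -> n < 2 ^ l.+1 ->
  2 * x + l <= n <= 2 * x + l + 1 -> 4 * J <= n <= 4 * J + 3 ->
  64 * (l + (r + 2) + 20) <= n -> 20 <= l -> 2 ^ (l - 3) <= J - (r + 2 + l + 9) ->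
  s = 2 ^ (x + l - 2 * (r + 2) - 13) ->
  s < d /\ sd3 e (fun => Z.of_nat (d - s)).
Proof.
move=> es ei deg_le colP /andP[d_gt d_le] nl xb Jb n_big l_gt J_j0 sE.
have s_le : s <= 2 ^ (n - 2) by rewrite sE leq_exp2l //; lia.
have dE : 2 ^ n.-1 = 2 ^ (n - 2) + 2 ^ (n - 2).
  by rewrite addnn -mul2n -expnS; congr expn; lia.
have s_lt : s < d by lia.
split=> //.
(* With [rho = r + 2] the left side is at most [2 ^ (n - 2)], while [d] exceeds twice that power and
   [s] is at most it. *)
have rt : r * 2 ^ (n - (r + 2)) < d - s.
  apply: (@leq_ltn_trans (2 ^ r * 2 ^ (n - (r + 2)))).
    by rewrite leq_mul2r ltnW ?orbT // ltn_expl.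
  by rewrite -expnD (_ : r + (n - (r + 2)) = n - 2); lia.
have [_ gT] : good e d s set0 setT.
  apply: (good_setT es ei deg_le s_lt colP rt) => C A B gC dAB dAC dBC A_indep A_C hA hB.
  apply: (good_random_component es ei deg_le s_lt d_le nl xb Jb n_big l_gt J_j0 sE) => //.
have sdT : sdn e setT (fun => d - s).
  apply: gT => v; first by rewrite subn_gt0.
  by rewrite in_set0 /plain leq_addr orbT.
by apply: (eq_sd3 sdT) => // u v; rewrite /restr !in_setT.
Qed.

Lemma leq_128_exp l : 20 <= l -> 128 * l <= 2 ^ l.
Proof.
move=> l20; rewrite -(subnK l20); elim: (l - 20) => [|m IH].
  by rewrite add0n (_ : 20 = 12 + 8) // expnD; have := ltn_expl 12 (isT : 1 < 2); lia.
by rewrite addSn expnS; lia.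
Qed.

(** [n] and [l] are the base 2 logarithms of [d], rounded up, and of [n], rounded down. The
    threshold on [d] forces [r + 22 <= l], so [64 * (l + (r + 2) + 20)] is at most [128 * l], hence
    at most [2 ^ l] and [n]. *)
Lemma parameters r d : 2 ^ (2 ^ (r + 22)) <= d -> exists n l x J,
  [/\ 2 ^ n.-1 < d <= 2 ^ n, n < 2 ^ l.+1,
      2 * x + l <= n <= 2 * x + l + 1 & 4 * J <= n <= 4 * J + 3] /\
  [/\ 64 * (l + (r + 2) + 20) <= n, 20 <= l & 2 ^ (l - 3) <= J - (r + 2 + l + 9)].
Proof.
move=> d_ge; have d_gt1 : 1 < d.
  by apply: leq_trans d_ge; apply: leq_ltn_trans (ltn_expl _ (isT : 1 < 2)); rewrite expn_gt0.
have n_bounds := up_log_bounds (isT : 1 < 2) d_gt1.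
move: (up_log 2 d) n_bounds => n /= n_bounds.
have n_ge : 2 ^ (r + 22) <= n.
  by rewrite -(@leq_exp2l 2) //; apply: leq_trans d_ge _; case/andP: n_bounds.
have n_gt0 : 0 < n by apply: leq_trans n_ge; rewrite expn_gt0.
have l_bounds := trunc_log_bounds (isT : 1 < 2) n_gt0.
have l_ge : r + 22 <= trunc_log 2 n by apply: trunc_log_max.
move: (trunc_log 2 n) l_bounds l_ge => l /= /andP[ln nl] l_ge.
have l128 : 128 * l <= 2 ^ l by apply: leq_128_exp; lia.
have lE : 2 ^ l = 8 * 2 ^ (l - 3) by rewrite -(@expnD 2 3); congr expn; lia.
exists n, l, ((n - l) %/ 2), (n %/ 4); split; split=> //; lia.
Qed.

(** The base of the square is [2 ^ (x + l + 1)], and [n + l + 1 <= 2 * (x + l + 1)]. The factor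
    [2 ^ (2 * r + 18)] becomes the inverse of the constant [c]. *)
Lemma parameters_sqrt r d n l x : d <= 2 ^ n -> n < 2 ^ l.+1 ->
  n <= 2 * x + l + 1 -> 64 * (l + (r + 2) + 20) <= n ->
  d * n <= (2 ^ (x + l - 2 * (r + 2) - 13) * 2 ^ (2 * r + 18)) ^ 2.
Proof.
move=> dn nl xn n_big; apply: (@leq_trans (2 ^ n * 2 ^ l.+1)).
  by rewrite leq_mul // ltnW.
by rewrite -!expnD -expnM leq_exp2l //; lia.
Qed.

Lemma ln_INR_le d n : 0 < d -> d <= 2 ^ n -> (ln (INR d) <= INR n)%R.
Proof.
move=> d0 dn; have d0R : (0 < INR d)%R by apply: lt_0_INR; lia.
have expE m : INR (2 ^ m) = (2 ^ m)%R.
  by elim: m => [|m IH]; [rewrite expn0|rewrite expnS mult_INR IH].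
have ln2 : (ln 2 <= 1)%R.
  rewrite -(ln_exp 1); apply: Rlt_le; apply: ln_increasing; first by Lra.lra.
  by have := exp_ineq1 1 R1_neq_R0; Lra.lra.
apply: (@Rle_trans _ (ln (2 ^ n)%R)).
  have := le_INR d (2 ^ n); rewrite expE => /(_ ltac:(lia)) [lt|->]; last exact: Rle_refl.
  by apply/Rlt_le/ln_increasing.
rewrite ln_pow; last by Lra.lra.
by have := Rmult_le_compat_l _ _ _ (pos_INR n) ln2; Lra.lra.
Qed.

Lemma sqrt_INR_le d n s m : 0 < d -> d <= 2 ^ n -> d * n <= (s * m) ^ 2 -> 0 < m ->
  (/ INR m * sqrt (INR d * ln (INR d)) <= INR s)%R.
Proof.
move=> d0 dn le_sm m0; have m0R : (0 < INR m)%R by apply: lt_0_INR; lia.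
apply: (@Rmult_le_reg_l (INR m)) => //.
rewrite -Rmult_assoc Rinv_r ?Rmult_1_l; last by Lra.lra.
have sm0 : (0 <= INR m * INR s)%R by apply: Rmult_le_pos; exact: pos_INR.
rewrite -(sqrt_square _ sm0); apply: sqrt_le_1_alt.
apply: (@Rle_trans _ (INR d * INR n)).
  by apply: Rmult_le_compat_l; [exact: pos_INR|exact: ln_INR_le].
rewrite -!mult_INR; apply: le_INR; move: le_sm; rewrite expnS expn1; lia.
Qed.

Lemma exists_least (P : nat -> Prop) k : P k -> exists m, P m /\ forall k', P k' -> m <= k'.
Proof.
elim/ltn_ind: k => k IH Pk.
have [[k' [lt_k' Pk']]|min_k] := classic (exists k', k' < k /\ P k'); first exact: IH Pk'.
exists k; split=> // k' Pk'; rewrite leqNgt; apply/negP => lt_k'.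
by apply: min_k; exists k'.
Qed.

Theorem theorem1p3 :
  forall r : nat, 2 <= r ->
  exists (d0 : nat) (c : R), 1 <= d0 /\ (0 < c)%R /\
  forall d : nat, d0 <= d ->
  forall (T : finType) (e : rel T),
    simple_graph e -> max_degree_le e d -> colorable e r ->
    exists k1 k2 : nat,
      is_chi_DPP e k1 /\ is_sd3 e k2 /\ k1 <= k2 /\
      (INR k2 <= INR d - c * sqrt (INR d * ln (INR d)))%R.
Proof.
move=> r _; exists (2 ^ (2 ^ (r + 22))), (/ INR (2 ^ (2 * r + 18)))%R.
have m0 : 0 < 2 ^ (2 * r + 18) by rewrite expn_gt0.
split; first by rewrite expn_gt0.
split; first by apply: Rinv_0_lt_compat; apply: lt_0_INR; lia.
move=> d d_ge T e [es ei] deg_le [col colP].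
have {}ei : irreflexive e by move=> v; apply: negbTE.
have [n [l [x [J [[d_bounds nl xb Jb] [n_big l_gt J_j0]]]]]] := parameters d_ge.
have [s_lt sd_s] := sd3_chromatic es ei deg_le colP d_bounds nl xb Jb n_big l_gt J_j0 erefl.
move: (2 ^ (_ - 13)) s_lt sd_s (@parameters_sqrt r d n l x) => s s_lt sd_s sm.
have [k2 [sd_k2 k2_min]] := exists_least (P := fun k => sd3 e (fun => Z.of_nat k)) sd_s.
(* Painter wins with [k2] tokens everywhere, which shows both that a least winning number exists and
   that it is at most [k2]. *)
have win2 : painter_wins e (fun => k2) set0.
  apply: (painter_wins_sd3 es ei (f := fun => Z.of_nat k2)) => //.
  by apply: (eq_sd3 sd_k2) => // u v; rewrite /restr !inE.
have [k1 [win1 k1_min]] := exists_least (P := fun k => painter_wins e (fun => k) set0) win2.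
exists k1, k2; split; first by split.
split; first by split.
split; first exact: k1_min.
have d0 : 0 < d by exact: leq_ltn_trans s_lt.
have [/andP[_ dn] /andP[_ xn]] := (d_bounds, xb).
have := sqrt_INR_le d0 dn (sm dn nl xn n_big) m0.
have : (INR k2 <= INR (d - s))%R by apply: le_INR; apply/ssrnat.leP/k2_min.
rewrite minus_INR; last by apply/ssrnat.leP/ltnW.
by Lra.lra.
Qed.
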